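(* Let $A,H$ be bialgebras or Hopf algebras forming a double cross coproduct $H\blacktriangleright\!\!\blacktriangleleft A$ with coactions $\alpha:A\to A\otimes H$, $\beta:H\to A\otimes H$. Then $H\blacktriangleright\!\!\blacktriangleleft A$ left-coacts on $H$ as a comodule algebra by $\Delta_Lh=h_{(1)}\otimes\beta(h_{(2)})$ for all $h\in H$, and right-coacts on $A$ as a comodule algebra by $\Delta_Ra=\alpha(a_{(1)})\otimes a_{(2)}$ for all $a\in A$. If moreover $\Omega(A),\Omega(H)$ are strongly bicovariant exterior algebras such that $\alpha,\beta$ are differentiable with extensions $\alpha_*:\Omega(A)\to\Omega(A)\underline\otimes\Omega(H)$, $\beta_*:\Omega(H)\to\Omega(A)\underline\otimes\Omega(H)$ satisfying $$(\Delta_{A*}\otimes\mathrm{id})\alpha_*(\omega)=\big((\mathrm{id}\otimes\beta_* )\alpha_*(\omega_{(1)})\big)\big(1_A\otimes\alpha_*(\omega_{(2)})\big),$$ $$(\mathrm{id}\otimes\Delta_{H*})\beta_*(\eta)=\big(\beta_*(\eta_{(1)})\otimes1_H\big)\big((\alpha_*\otimes\mathrm{id})\beta_*(\eta_{(2)})\big),$$ $$\alpha_*(\omega)\beta_*(\eta)=(-1)^{|\omega||\eta|}\beta_*(\eta)\alpha_*(\omega)$$ for all $\omega\in\Omega(A)$, $\eta\in\Omega(H)$, and $H\blacktriangleright\!\!\blacktriangleleft A$ has the exterior algebra $\Omega(H\blacktriangleright\!\!\blacktriangleleft A):=\Omega(H)\blacktriangleright\!\!\blacktriangleleft\Omega(A)$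 with differential $d(\eta\otimes\omega)=d_H\eta\otimes\omega+(-1)^{|\eta|}\eta\otimes d_A\omega$, then both coactions $\Delta_L$ and $\Delta_R$ are differentiable.
   Context: Work over a field $k$. An exterior algebra on an algebra $A$ is a differential graded algebra $\Omega(A)=\oplus_{n\ge0}\Omega^n(A)$ with $\Omega^0=A$, generated by $A$ and $\Omega^1=\mathrm{span}\{a\,db\}$, with $d^2=0$ and graded Leibniz rule. The super tensor product $\underline\otimes$ has product $(a\otimes b)(c\otimes d)=(-1)^{|b||c|}ac\otimes bd$ and, for DGAs, differential $d\otimes\mathrm{id}+(-1)^{|\ |}\mathrm{id}\otimes d$, where $(-1)^{|\ |}\omega=(-1)^{|\omega|}\omega$. For $A$ a bialgebra (resp. Hopf algebra), $\Omega(A)$ is strongly bicovariant if it is a super-bialgebra (resp. super-Hopf algebra) with super grade the form degree mod 2, with coproduct $\Delta_*$ preserving total degree, restricting to $\Delta$ on $A$, and $\Delta_*d\omega=(d\otimes\mathrm{id}+(-1)^{|\ |}\mathrm{id}\otimes d)\Delta_*\omega$. Sweedler notation is with homogeneous components; products in multiple tensor products are in the super tensor product algebra. A right coaction $\Delta_R:B\to B\otimes K$ making $B$ a $K$-comodule algebra is differentiable (for exterior algebras $\Omega(B),\Omega(K)$) if it extends to a total-degree-preserving map of DGAs $\Delta_{R*}:\Omega(B)\to\Omega(B)\underline\otimes\Omega(K)$; similarly a left coaction extends to $\Delta_{L*}:\Omega(B)\to\Omega(K)\underline\otimes\Omega(B)$. A double cross coproduct $H\blacktriangleright\!\!\blacktriangleleft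 A$: $A$ is a right $H$-comodule algebra by $\alpha$, $H$ is a left $A$-comodule algebra by $\beta$, compatible (the three displayed conditions of the claim restricted to degree 0) so that $H\otimes A$ with tensor product algebra and counit and coproduct $\Delta(h\otimes a)=h_{(1)}\otimes\alpha(a_{(1)})\beta(h_{(2)})\otimes a_{(2)}$ is a bialgebra or Hopf algebra. Differentiability of $\alpha,\beta$ here means $\alpha_*,\beta_*$ are moreover super comodule algebra structures (of $\Omega(H)$ on $\Omega(A)$ from the right and of $\Omega(A)$ on $\Omega(H)$ from the left) commuting with differentials. $\Omega(H)\blacktriangleright\!\!\blacktriangleleft\Omega(A)$ is $\Omega(H)\underline\otimes\Omega(A)$ with super tensor product algebra and counit, and $\Delta_*(\eta\otimes\omega)=(-1)^{|\omega_{(1)}||\eta_{(2)}|}\eta_{(1)}\otimes\alpha_*(\omega_{(1)})\beta_*(\eta_{(2)})\otimes\omega_{(2)}$. *)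

(* Defs.v *)
From HB Require Import structures.
From mathcomp Require Import all_boot all_order all_algebra.
From mathcomp Require Import boolp classical_sets.

Set Implicit Arguments.
Unset Strict Implicit.
Unset Printing Implicit Defensive.

Import GRing.Theory.
Local Open Scope ring_scope.
Local Open Scope classical_set_scope.
Local Open Scope quotient_scope.

(* Locked, so that simplification does not expose the function under the
   linear map. *)
HB.lock Definition mklin (k : fieldType) (U V : lmodType k) (f : U -> V)
  (hf : linear f) : {linear U -> V} :=
  HB.pack f (GRing.isLinear.Build k U V *:%R f hf).
Arguments mklin {k U V f} hf.

Lemma mklinE (k : fieldType) (U V : lmodType k) (f : U -> V) (hf : linear f) x :
  mklin hf x = f x.
Proof. by rewrite mklin.unlock. Qed.

Definition bilin (k : fieldType) (V W U : lmodType k) (f : V -> W -> U) : Prop :=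
  (forall w, linear (f^~ w)) /\ (forall v, linear (f v)).

(* The tensor product over k: formal sums of pairs (v, w), two of which are
   identified when no bilinear map out of V x W separates them. *)
Section Tensor.
Variables (k : fieldType) (V W : lmodType k).

Definition teq (s t : seq (V * W)) : bool :=
  `[< forall (U : lmodType k) (f : V -> W -> U), bilin f ->
        \sum_(p <- s) f p.1 p.2 = \sum_(p <- t) f p.1 p.2 >].

Fact teq_refl : reflexive teq.
Proof. by move=> s; apply/asboolP. Qed.
Fact teq_sym : symmetric teq.
Proof. by move=> s t; apply/asboolP/asboolP => h U f hf; rewrite h. Qed.
Fact teq_trans : transitive teq.
Proof.
move=> t s u /asboolP h1 /asboolP h2; apply/asboolP => U f hf.
by rewrite h1 // h2.
Qed.

Canonical teq_equiv := EquivRel teq teq_refl teq_sym teq_trans.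

Definition tensor := {eq_quot teq}.
HB.instance Definition _ := Choice.on tensor.

Definition tpi (s : seq (V * W)) : tensor := \pi_({eq_quot teq}) s.
Definition trepr (x : tensor) : seq (V * W) := repr x.

Definition teval (U : lmodType k) (f : V -> W -> U) (x : tensor) : U :=
  \sum_(p <- trepr x) f p.1 p.2.

Lemma teval_pi (U : lmodType k) (f : V -> W -> U) s :
  bilin f -> teval f (tpi s) = \sum_(p <- s) f p.1 p.2.
Proof.
move=> hf; rewrite /teval.
have /asboolP h : teq (trepr (tpi s)) s.
  by apply/eqmodP; rewrite /trepr /tpi reprK.
exact: h.
Qed.

Lemma teval_ext (x y : tensor) :
  (forall (U : lmodType k) (f : V -> W -> U), bilin f -> teval f x = teval f y) ->
  x = y.
Proof.
move=> h; rewrite -[x]reprK -[y]reprK; apply/eqmodP/asboolP => U f hf.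
exact: h.
Qed.

Definition tadd (x y : tensor) : tensor := tpi (trepr x ++ trepr y).
Definition tscale (a : k) (x : tensor) : tensor :=
  tpi [seq (a *: p.1, p.2) | p <- trepr x].
Definition topp (x : tensor) : tensor := tscale (-1) x.
Definition tzero : tensor := tpi [::].

Section Eval.
Variables (U : lmodType k) (f : V -> W -> U) (hf : bilin f).

Lemma bilinZl a v w : f (a *: v) w = a *: f v w.
Proof. by rewrite -!(mklinE (hf.1 w)) linearZ_LR. Qed.

Lemma teval_add x y : teval f (tadd x y) = teval f x + teval f y.
Proof. by rewrite teval_pi // big_cat. Qed.

Lemma teval_scale a x : teval f (tscale a x) = a *: teval f x.
Proof.
rewrite teval_pi // big_map scaler_sumr; apply: eq_bigr => p _.
by rewrite bilinZl.
Qed.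

Lemma teval_opp x : teval f (topp x) = - teval f x.
Proof. by rewrite teval_scale scaleN1r. Qed.

Lemma teval_zero : teval f tzero = 0.
Proof. by rewrite teval_pi // big_nil. Qed.

End Eval.

Let tE := (teval_add, teval_opp, teval_zero, teval_scale).

Fact taddA : associative tadd.
Proof. by move=> x y z; apply: teval_ext => U f hf; rewrite !tE // addrA. Qed.
Fact taddC : commutative tadd.
Proof. by move=> x y; apply: teval_ext => U f hf; rewrite !tE // addrC. Qed.
Fact tadd0 : left_id tzero tadd.
Proof. by move=> x; apply: teval_ext => U f hf; rewrite !tE // add0r. Qed.
Fact taddN : left_inverse tzero topp tadd.
Proof. by move=> x; apply: teval_ext => U f hf; rewrite !tE // addNr. Qed.

HB.instance Definition _ := GRing.isZmodule.Build tensor taddA taddC tadd0 taddN.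

Fact tscaleA a b x : tscale a (tscale b x) = tscale (a * b) x.
Proof. by apply: teval_ext => U f hf; rewrite !tE // scalerA. Qed.
Fact tscale1 : left_id 1 tscale.
Proof. by move=> x; apply: teval_ext => U f hf; rewrite !tE // scale1r. Qed.
Fact tscaleDr : right_distributive tscale +%R.
Proof.
move=> a x y; apply: teval_ext => U f hf.
by rewrite /GRing.add /= !tE // scalerDr.
Qed.
Fact tscaleDl x : {morph tscale^~ x : a b / a + b}.
Proof.
move=> a b; apply: teval_ext => U f hf.
by rewrite {2}/GRing.add /= !tE // scalerDl.
Qed.

HB.instance Definition _ :=
  GRing.Zmodule_isLmodule.Build k tensor tscaleA tscale1 tscaleDr tscaleDl.

Definition pure (v : V) (w : W) : tensor := tpi [:: (v, w)].

Fact teval_linear (U : lmodType k) (f : V -> W -> U) : bilin f -> linear (teval f).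
Proof. by move=> hf a x y; rewrite -[a *: x]/(tscale a x) -[_ + y]/(tadd _ y) !tE. Qed.

(* Universal property: existence is tlift, tliftE; uniqueness is tensor_ext. *)
Definition tlift (U : lmodType k) (f : V -> W -> U) (hf : bilin f) :
  {linear tensor -> U} := mklin (teval_linear hf).

Lemma tliftE (U : lmodType k) (f : V -> W -> U) (hf : bilin f) v w :
  tlift hf (pure v w) = f v w.
Proof. by rewrite mklinE teval_pi // big_seq1. Qed.

Lemma pure_bilin : bilin pure.
Proof.
split=> [w|v] a x y; apply: teval_ext => U f hf;
  rewrite -[_ *: pure _ _]/(tscale _ _) -[_ + pure _ _]/(tadd _ _) !tE //.
- by rewrite !teval_pi // !big_seq1 /= (hf.1 w).
- by rewrite !teval_pi // !big_seq1 /= (hf.2 v).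
Qed.

Lemma tensor_sum x : x = \sum_(p <- trepr x) pure p.1 p.2.
Proof.
apply: teval_ext => U f hf; rewrite -[RHS](mklinE (teval_linear hf)) linear_sum.
by rewrite /teval; apply: eq_bigr => p _; rewrite tliftE.
Qed.

Lemma tensor_ind (P : tensor -> Prop) :
  P 0 -> (forall x y, P x -> P y -> P (x + y)) -> (forall v w, P (pure v w)) ->
  forall x, P x.
Proof.
move=> h0 hD hp x; rewrite (tensor_sum x).
by elim: (trepr x) => [|p s IH]; rewrite ?big_nil ?big_cons //; apply: hD.
Qed.

Lemma tensor_ext (U : lmodType k) (f g : {linear tensor -> U}) :
  (forall v w, f (pure v w) = g (pure v w)) -> f =1 g.
Proof.
move=> h; apply: tensor_ind => [|x y hx hy|//]; first by rewrite !linear0.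
by rewrite !linearD hx hy.
Qed.

End Tensor.


Notation "V '\ot' W" := (tensor V W) (at level 40, left associativity).
Notation "v '\ox' w" := (pure v w) (at level 40, left associativity) : ring_scope.
Section LinearForm.
Variables (k : fieldType) (V : lmodType k) (v0 : V).

Let subsp (M : set V) : Prop :=
  [/\ M 0, (forall a x y, M x -> M y -> M (a *: x + y)) & ~ M v0].

Lemma linear_form_neq0 : v0 != 0 -> exists f : {scalar V}, f v0 = 1.
Proof.
move=> v0n0.
have [M [[M0 ML Mv] Mmax]] : exists M, subsp M /\ forall B, M `<` B -> ~ subsp B.
  pose P (M : set V) := (forall a x y, M x -> M y -> M (a *: x + y)) /\
    ~ M v0 /\ forall x, M x -> M 0.
  have [M [[ML [Mv Mz]] Mmax]] : exists M, P M /\ forall B, M `<` B -> ~ P B.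
    apply: Zorn_bigcup => F FP tot; split; [|split].
    - move=> a x y [X FX Xx] [Y FY Yy].
      have [XY|YX] := tot _ _ FX FY.
        by exists Y => //; apply: (FP _ FY).1 => //; apply: XY.
      by exists X => //; apply: (FP _ FX).1 => //; apply: YX.
    - by move=> [X FX Xv]; apply: (FP _ FX).2.1.
    - by move=> x [X FX Xx]; exists X => //; apply: (FP _ FX).2.2 Xx.
  have M0 : M 0.
    apply: contrapT => nM0; apply: (Mmax [set 0]).
      split=> [|h]; last exact/nM0/h.
      by move=> x /Mz.
    split=> [a x y -> ->|]; first by rewrite scaler0 addr0.
    by split=> [/eqP|//]; rewrite (negPf v0n0).
  exists M; split; first by split.
  by move=> B MB [B0 BL Bv]; apply: (Mmax B MB); split.
have dec x : exists c, M (x - c *: v0).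
  have [Mx|nMx] := EM (M x); first by exists 0; rewrite scale0r subr0.
  pose B : set V := [set y | exists c, M (y - c *: x)].
  have : ~ subsp B.
    apply: Mmax; split; first by move=> y My; exists 0; rewrite scale0r subr0.
    by move=> h; apply/nMx/h; exists 1; rewrite scale1r subrr.
  have [[c Mc] _|nB []] := EM (B v0).
    have c0 : c != 0 by apply: contra_notN Mv => /eqP c0; move: Mc; rewrite c0 scale0r subr0.
    exists c^-1; have := ML (- c^-1) _ _ Mc M0.
    rewrite addr0 scalerBr scalerA mulNr mulVf // scaleN1r opprK scaleNr.
    by rewrite addrC.
  split=> //; first by exists 0; rewrite scale0r subr0.
  move=> a y z [c Mc] [c' Mc']; exists (a * c + c').
  have := ML a _ _ Mc Mc'.
  by rewrite scalerBr scalerA addrACA -opprD -scalerDl.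
pose f x := sval (cid (dec x)).
have fP x : M (x - f x *: v0) by rewrite /f; case: cid.
have uniq x c c' : M (x - c *: v0) -> M (x - c' *: v0) -> c = c'.
  move=> h h'; apply: contrapT => /eqP ne; apply: Mv.
  have := ML (-1) _ _ h h'.
  rewrite scaleN1r opprB addrA subrK -scalerBl => h2.
  have := ML (c - c')^-1 _ _ h2 M0.
  by rewrite addr0 scalerA mulVf ?subr_eq0 // scale1r.
have flin : linear_for *%R f.
  move=> a x y; apply: (uniq (a *: x + y)); first exact: fP.
  have := ML a _ _ (fP x) (fP y).
  by rewrite scalerBr scalerA addrACA -opprD -scalerDl.
pose F : {scalar V} := HB.pack f (GRing.isLinear.Build k V k *%R f flin).
exists F; apply: (uniq v0); first exact: fP.
by rewrite scale1r subrr.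
Qed.

End LinearForm.

Lemma pure_neq0 (k : fieldType) (V W : lmodType k) (v : V) (w : W) :
  v != 0 -> w != 0 -> v \ox w != 0.
Proof.
move=> /linear_form_neq0 [f fv] /linear_form_neq0 [g gw].
pose h (x : V) (y : W) : k^o := f x * g y.
have hb : bilin h.
  split=> [y|x] a u u'; rewrite /h linearP.
    by rewrite mulrDl -mulrA.
  by rewrite mulrDr mulrCA.
apply: contra_neq (oner_neq0 k) => e.
by have := tliftE hb v w; rewrite e linear0 /h fv gw mulr1.
Qed.

Section TensorMaps.
Variable k : fieldType.

Section Bilin.
Variables (V W U : lmodType k) (f : V -> W -> U) (hf : bilin f).
Lemma bilinDl v v' w : f (v + v') w = f v w + f v' w.
Proof. by rewrite -!(mklinE (hf.1 w)) linearD. Qed.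
Lemma bilinDr v w w' : f v (w + w') = f v w + f v w'.
Proof. by rewrite -!(mklinE (hf.2 v)) linearD. Qed.
Lemma bilinZr a v w : f v (a *: w) = a *: f v w.
Proof. by rewrite -!(mklinE (hf.2 v)) linearZ_LR. Qed.
Lemma bilin0l w : f 0 w = 0.
Proof. by rewrite -!(mklinE (hf.1 w)) linear0. Qed.
Lemma bilin0r v : f v 0 = 0.
Proof. by rewrite -!(mklinE (hf.2 v)) linear0. Qed.
Lemma bilin_suml I (r : seq I) (P : pred I) (F : I -> V) w :
  f (\sum_(i <- r | P i) F i) w = \sum_(i <- r | P i) f (F i) w.
Proof.
rewrite -(mklinE (hf.1 w)) linear_sum; apply: eq_bigr => i _; exact: mklinE.
Qed.
Lemma bilin_sumr I (r : seq I) (P : pred I) (F : I -> W) v :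
  f v (\sum_(i <- r | P i) F i) = \sum_(i <- r | P i) f v (F i).
Proof.
rewrite -(mklinE (hf.2 v)) linear_sum; apply: eq_bigr => i _; exact: mklinE.
Qed.
End Bilin.

Section Lift3.
Variables (U V W X : lmodType k).
Lemma bilin_liftl (F : W -> U -> V -> X) (hF : forall w, bilin (F w)) :
  (forall u v, linear (fun w => F w u v)) -> bilin (fun t w => tlift (hF w) t).
Proof.
move=> h; split=> [w|t] a x y; first by rewrite linearP.
elim/tensor_ind: t => [|t t' ht ht'|u v]; rewrite ?linear0 ?scaler0 ?addr0 //.
  by rewrite !linearD ht ht' addrACA.
by rewrite !tliftE h.
Qed.
Lemma bilin_liftr (F : W -> U -> V -> X) (hF : forall w, bilin (F w)) :
  (forall u v, linear (fun w => F w u v)) -> bilin (fun w t => tlift (hF w) t).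
Proof. by case/(bilin_liftl hF) => h1 h2; split. Qed.
End Lift3.

Section Maps.
Variables (V V' W W' : lmodType k).

Fact tmap_bilin (f : {linear V -> V'}) (g : {linear W -> W'}) :
  bilin (fun v w => f v \ox g w).
Proof.
by split=> [w|v] a x y; rewrite linearP ?((pure_bilin _ _).1, (pure_bilin _ _).2).
Qed.

Definition tmap (f : {linear V -> V'}) (g : {linear W -> W'}) :
  {linear V \ot W -> V' \ot W'} := tlift (tmap_bilin f g).

Lemma tmapE f g v w : tmap f g (v \ox w) = f v \ox g w.
Proof. exact: tliftE. Qed.

Fact tcontl_bilin (f : {scalar V}) : bilin (fun v (w : W) => f v *: w).
Proof.
split=> [w|v] a x y; rewrite linearP.
  by rewrite scalerDl scalerA.
by rewrite scalerA mulrC -scalerA.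
Qed.
Fact tcontr_bilin (f : {scalar W}) : bilin (fun (v : V) w => f w *: v).
Proof.
split=> [w|v] a x y; rewrite linearP.
  by rewrite scalerA mulrC -scalerA.
by rewrite scalerDl scalerA.
Qed.

End Maps.

Definition tcontl (V W : lmodType k) (f : {scalar V}) : {linear V \ot W -> W} :=
  tlift (tcontl_bilin W f).
Definition tcontr (V W : lmodType k) (f : {scalar W}) : {linear V \ot W -> V} :=
  tlift (tcontr_bilin V f).

Lemma tcontlE (V W : lmodType k) (f : {scalar V}) v (w : W) :
  tcontl W f (v \ox w) = f v *: w.
Proof. exact: tliftE. Qed.
Lemma tcontrE (V W : lmodType k) (f : {scalar W}) (v : V) w :
  tcontr V f (v \ox w) = f w *: v.
Proof. exact: tliftE. Qed.

Section Assoc.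
Variables (U V W : lmodType k).

Fact tassoc_bilin1 (w : W) : bilin (fun (u : U) (v : V) => u \ox (v \ox w)).
Proof. by split=> [v|u] a x y; rewrite !((pure_bilin _ _).1, (pure_bilin _ _).2). Qed.
Fact tassoc_bilin2 : bilin (fun t w => tlift (tassoc_bilin1 w) t).
Proof.
by apply: bilin_liftl => u v a x y; rewrite !(pure_bilin _ _).2.
Qed.
Definition tassoc : {linear (U \ot V) \ot W -> U \ot (V \ot W)} :=
  tlift tassoc_bilin2.
Lemma tassocE u v w : tassoc (u \ox v \ox w) = u \ox (v \ox w).
Proof. by rewrite /tassoc !tliftE. Qed.

Fact tassocV_bilin1 (u : U) : bilin (fun (v : V) (w : W) => u \ox v \ox w).
Proof. by split=> [w|v] a x y; rewrite !((pure_bilin _ _).1, (pure_bilin _ _).2). Qed.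
Fact tassocV_bilin2 : bilin (fun u t => tlift (tassocV_bilin1 u) t).
Proof.
by apply: bilin_liftr => v w a x y; rewrite !(pure_bilin _ _).1.
Qed.
Definition tassocV : {linear U \ot (V \ot W) -> (U \ot V) \ot W} :=
  tlift tassocV_bilin2.
Lemma tassocVE u v w : tassocV (u \ox (v \ox w)) = u \ox v \ox w.
Proof. by rewrite !tliftE. Qed.

End Assoc.

End TensorMaps.

Arguments tassoc {k U V W}.
Arguments tassocV {k U V W}.


(* N-graded algebras.  The n-th component is the image of the projection gpr n,
   and the algebra is the direct sum of its components. *)
Record galg (k : fieldType) := Galg {
  galg_alg :> algType k;
  gpr : nat -> {linear galg_alg -> galg_alg};
  gpr_gpr : forall m n x, gpr m (gpr n x) = if m == n then gpr n x else 0;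
  gpr_fin : forall x, exists N, x == \sum_(n < N) gpr n x;
  gpr_1 : gpr 0 1 = 1;
  gpr_M : forall m n x y,
    gpr m x = x -> gpr n y = y -> gpr (m + n) (x * y) = x * y
}.

Arguments gpr {k g} n.

Section Graded.
Variables (k : fieldType) (X : galg k).
Implicit Types x y : X.

Definition homog n x : Prop := gpr n x = x.

Lemma homog_gpr n x : homog n (gpr n x).
Proof. by rewrite /homog gpr_gpr eqxx. Qed.
Lemma gpr_homog m n x : homog n x -> gpr m x = if m == n then x else 0.
Proof. by move=> h; rewrite -{1}h gpr_gpr h. Qed.
Lemma homog0 n : homog n (0 : X). Proof. exact: linear0. Qed.
Lemma homogD n x y : homog n x -> homog n y -> homog n (x + y).
Proof. by move=> hx hy; rewrite /homog linearD hx hy. Qed.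
Lemma homogZ n a x : homog n x -> homog n (a *: x).
Proof. by move=> hx; rewrite /homog linearZ_LR /= hx. Qed.
Lemma homog_sum n I (r : seq I) (P : pred I) (F : I -> X) :
  (forall i, P i -> homog n (F i)) -> homog n (\sum_(i <- r | P i) F i).
Proof. by move=> h; elim/big_ind: _ => //; [exact: homog0 | exact: homogD]. Qed.
Lemma homog1 : homog 0 (1 : X). Proof. exact: gpr_1. Qed.
Lemma homogM m n x y : homog m x -> homog n y -> homog (m + n) (x * y).
Proof. exact: gpr_M. Qed.

Lemma gind (P : X -> Prop) :
  P 0 -> (forall x y, P x -> P y -> P (x + y)) ->
  (forall n x, homog n x -> P x) -> forall x, P x.
Proof.
move=> h0 hD hP x; have [N /eqP ->] := gpr_fin x.
by elim/big_ind: _ => // i _; apply: (hP i); apply: homog_gpr.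
Qed.

Lemma gext (V : lmodType k) (f g : {linear X -> V}) :
  (forall n x, homog n x -> f x = g x) -> f =1 g.
Proof.
move=> h; apply: gind => [|x y hx hy|n x hx]; first by rewrite !linear0.
  by rewrite !linearD hx hy.
exact: h hx.
Qed.

Definition gtop x : nat := ex_minn (gpr_fin x).

Lemma gtopP x n : (gtop x <= n)%N -> gpr n x = 0.
Proof.
rewrite /gtop; case: ex_minnP => N /eqP e _ Nn.
rewrite e linear_sum big1 // => i _; rewrite gpr_gpr.
by case: eqP => // ni; move: Nn; rewrite ni leqNgt ltn_ord.
Qed.

Lemma gtop_sum (V : lmodType k) (F : nat -> {linear X -> V}) x N :
  (gtop x <= N)%N ->
  \sum_(n < gtop x) F n (gpr n x) = \sum_(n < N) F n (gpr n x).
Proof.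
move=> h; rewrite (big_ord_widen _ (fun n => F n (gpr n x)) h) big_mkcond /=.
apply: eq_bigr => i _; case: ltnP => // hi.
by rewrite gtopP ?linear0.
Qed.

(* s n times the identity on the n-th component *)
Section Weight.
Variable s : nat -> k.

Fact gweight_linear : linear (fun x => \sum_(n < gtop x) s n *: gpr n x).
Proof.
move=> a x y; pose F n : {linear X -> X} := s n \*: idfun.
pose N := maxn (gtop (a *: x + y)) (maxn (gtop x) (gtop y)).
have e z : (gtop z <= N)%N ->
    \sum_(n < gtop z) s n *: gpr n z = \sum_(n < N) s n *: gpr n z.
  by move=> /(gtop_sum F) ->.
rewrite !e ?/N ?leq_max ?leqnn ?orbT // scaler_sumr -big_split /=.
by apply: eq_bigr => i _; rewrite linearP scalerDr !scalerA mulrC.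
Qed.
Definition gweight : {linear X -> X} := mklin gweight_linear.

Lemma gweightE n x : homog n x -> gweight x = s n *: x.
Proof.
move=> hx; pose F n : {linear X -> X} := s n \*: idfun.
rewrite mklinE (@gtop_sum _ F _ (maxn (gtop x) n.+1)) ?leq_maxl //=.
have hn : (n < maxn (gtop x) n.+1)%N by rewrite leq_max ltnSn orbT.
rewrite (bigD1 (Ordinal hn)) //= hx big1 ?addr0 // => i ne.
by rewrite (gpr_homog _ hx) -[i == n :> nat]/(i == Ordinal hn) (negPf ne) scaler0.
Qed.
End Weight.

(* x |-> (-1)^|x| x, and the even and odd parts of x *)
Definition gsign : {linear X -> X} := gweight (fun n => (-1) ^+ n).
Definition gev : {linear X -> X} := gweight (fun n => (~~ odd n)%:R).
Definition god : {linear X -> X} := gweight (fun n => (odd n)%:R).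

Lemma gsignE n x : homog n x -> gsign x = (-1) ^+ n *: x.
Proof. exact: gweightE. Qed.

End Graded.

Section TensorHomog.
Variables (k : fieldType) (X Y : galg k).

Lemma tensor_hind (P : X \ot Y -> Prop) :
  P 0 -> (forall x y, P x -> P y -> P (x + y)) ->
  (forall m n x y, homog m x -> homog n y -> P (x \ox y)) -> forall t, P t.
Proof.
move=> h0 hD hP; apply: tensor_ind => // x y.
elim/gind: x => [|x x' hx hx'|m x hx]; rewrite ?(bilin0l (pure_bilin X Y)) //.
  by rewrite (bilinDl (pure_bilin X Y)); apply: hD.
elim/gind: y => [|y y' hy hy'|n y hy]; rewrite ?(bilin0r (pure_bilin X Y)) //.
  by rewrite (bilinDr (pure_bilin X Y)); apply: hD.
exact: hP hx hy.
Qed.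

Lemma tensor_hext (V : lmodType k) (f g : {linear X \ot Y -> V}) :
  (forall m n x y, homog m x -> homog n y -> f (x \ox y) = g (x \ox y)) ->
  f =1 g.
Proof.
move=> h; apply: tensor_hind => [|x y hx hy|m n x y hx hy].
- by rewrite !linear0.
- by rewrite !linearD hx hy.
- exact: h hx hy.
Qed.

(* x \ox y |-> (-1)^(|x||y|) y \ox x *)
Fact sflip_bilin : bilin (fun (x : X) (y : Y) => gev Y y \ox x + god Y y \ox gsign X x).
Proof.
by split=> [y|x] a u v;
  rewrite !linearP !((pure_bilin _ _).1, (pure_bilin _ _).2) scalerDr addrACA.
Qed.
Definition sflip : {linear X \ot Y -> Y \ot X} := tlift sflip_bilin.

Lemma sflipE m n x y : homog m x -> homog n y ->
  sflip (x \ox y) = (-1) ^+ (m * n) *: (y \ox x).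
Proof.
move=> hx hy; rewrite tliftE (gweightE _ hy) (gweightE _ hy) (gweightE _ hx).
rewrite !(bilinZl (pure_bilin _ _)) !(bilinZr (pure_bilin _ _)).
rewrite -[(-1) ^+ m]signr_odd -[(-1) ^+ (m * n)]signr_odd oddM.
by case: (odd n); rewrite /= ?andbT ?andbF scale0r ?scale1r ?add0r ?addr0 ?expr0 ?scale1r.
Qed.

End TensorHomog.
Arguments sflip {k X Y}.
Arguments homog {k X} n x.

Section SuperTensor.
Variables (k : fieldType) (X Y : galg k).
Notation T := (X \ot Y).

Definition stmul1 (a : X) (b : Y) (c : X) (d : Y) : T :=
  (a * c) \ox (gev Y b * d) + (a * gsign X c) \ox (god Y b * d).

Fact stmul_bilin1 a b : bilin (stmul1 a b).
Proof.
split=> [d|c] u v w; rewrite /stmul1 ?linearP !mulrDr -!scalerAr.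
  by rewrite !(pure_bilin _ _).1 scalerDr addrACA.
by rewrite !(pure_bilin _ _).2 scalerDr addrACA.
Qed.
Fact stmul_bilin2 (t : T) : bilin (fun a b => tlift (stmul_bilin1 a b) t).
Proof.
split=> [b|a].
  apply: (bilin_liftr (fun a => stmul_bilin1 a b) _).1 => c d u v w.
  rewrite /stmul1 !mulrDl -!scalerAl !(pure_bilin _ _).1.
  by rewrite scalerDr addrACA.
apply: (bilin_liftr (stmul_bilin1 a) _).1 => c d u v w.
rewrite /stmul1 !linearP !mulrDl -!scalerAl !(pure_bilin _ _).2.
by rewrite scalerDr addrACA.
Qed.

Definition stmul (s t : T) : T := tlift (stmul_bilin2 t) s.

Fact stmul_bilin : bilin stmul.
Proof. by apply: bilin_liftl => a b u v w; rewrite linearP. Qed.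

Lemma stmul_pure m n (a : X) (b : Y) (c : X) (d : Y) :
  homog m b -> homog n c ->
  stmul (a \ox b) (c \ox d) = (-1) ^+ (m * n) *: ((a * c) \ox (b * d)).
Proof.
move=> hb hc; rewrite /stmul !tliftE /stmul1.
rewrite (gweightE _ hb) (gweightE _ hb) (gweightE _ hc) -!scalerAl -!scalerAr.
rewrite !(bilinZl (pure_bilin _ _)) !(bilinZr (pure_bilin _ _)).
rewrite -[(-1) ^+ n]signr_odd -[(-1) ^+ (m * n)]signr_odd oddM.
case: (odd m); first by rewrite /= scale0r !scale1r add0r.
by rewrite /= scale0r !scale1r scaler0 addr0.
Qed.

Lemma stmul_ind3 (P : T -> T -> T -> Prop) :
  (forall t u, P 0 t u) -> (forall s s' t u, P s t u -> P s' t u -> P (s + s') t u) ->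
  (forall s u, P s 0 u) -> (forall s t t' u, P s t u -> P s t' u -> P s (t + t') u) ->
  (forall s t, P s t 0) -> (forall s t u u', P s t u -> P s t u' -> P s t (u + u')) ->
  (forall i a j b i' a' j' b' i'' a'' j'' b'',
    homog i a -> homog j b -> homog i' a' -> homog j' b' ->
    homog i'' a'' -> homog j'' b'' ->
    P (a \ox b) (a' \ox b') (a'' \ox b'')) ->
  forall s t u, P s t u.
Proof.
move=> h1 h1' h2 h2' h3 h3' h.
elim/tensor_hind=> [||i j a b ha hb] //.
  by move=> s s' hs hs' t u; apply: h1'.
elim/tensor_hind=> [||i' j' a' b' ha' hb'] //.
  by move=> s s' hs hs' u; apply: h2'.
elim/tensor_hind=> [||i'' j'' a'' b'' ha'' hb''] //.
  by move=> s s'; apply: h3'.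
exact: (h _ _ _ _ _ _ _ _ _ _ _ _ ha hb ha' hb' ha'' hb'').
Qed.

Fact stmulA : associative stmul.
Proof.
have H := stmul_bilin.
apply: (@stmul_ind3 (fun s t u => stmul s (stmul t u) = stmul (stmul s t) u))
  => [t u|s s' t u h h'|s u|s t t' u h h'|s t|s t u u' h h'|
  i a j b i' a' j' b' i'' a'' j'' b'' ha hb ha' hb' ha'' hb''].
- by rewrite !(bilin0l H).
- by rewrite !(bilinDl H) h h'.
- by rewrite !(bilin0l H, bilin0r H).
- by rewrite !(bilinDl H, bilinDr H) h h'.
- by rewrite !(bilin0r H).
- by rewrite !(bilinDr H) h h'.
rewrite (stmul_pure _ _ hb' ha'') (stmul_pure _ _ hb ha').
rewrite (bilinZl H) (bilinZr H) (stmul_pure _ _ hb (homogM ha' ha'')).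
rewrite (stmul_pure _ _ (homogM hb hb') ha'') !scalerA -!exprD !mulrA.
congr ((-1) ^+ _ *: _).
by rewrite mulnDl mulnDr addnC -addnA.
Qed.

Fact stmul1l : left_id (1 \ox 1) stmul.
Proof.
elim/tensor_hind => [|s t hs ht|m n a b ha hb]; rewrite ?(bilin0r stmul_bilin) //.
  by rewrite (bilinDr stmul_bilin) hs ht.
by rewrite (stmul_pure _ _ (homog1 _) ha) expr0 scale1r !mul1r.
Qed.

Fact stmul1r : right_id (1 \ox 1) stmul.
Proof.
elim/tensor_hind => [|s t hs ht|m n a b ha hb]; rewrite ?(bilin0l stmul_bilin) //.
  by rewrite (bilinDl stmul_bilin) hs ht.
by rewrite (stmul_pure _ _ hb (homog1 _)) muln0 expr0 scale1r !mulr1.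
Qed.

Definition stens := T.
HB.instance Definition _ := GRing.Lmodule.on stens.
HB.instance Definition _ := GRing.Zmodule_isNzRing.Build stens stmulA stmul1l stmul1r
  (fun x y z => bilinDl stmul_bilin x y z) (fun x y z => bilinDr stmul_bilin x y z)
  (pure_neq0 (oner_neq0 X) (oner_neq0 Y)).
HB.instance Definition _ := GRing.Lmodule_isLalgebra.Build k stens
  (fun a x y => esym (bilinZl stmul_bilin a x y)).
HB.instance Definition _ := GRing.Lalgebra_isAlgebra.Build k stens
  (fun a x y => esym (bilinZr stmul_bilin a x y)).

Definition tgpr_fun n (t : T) : T := \sum_(i < n.+1) tmap (gpr i) (gpr (n - i)) t.
Fact tgpr_linear n : linear (tgpr_fun n).
Proof.
move=> a x y; rewrite /tgpr_fun scaler_sumr -big_split /=.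
by apply: eq_bigr => i _; rewrite linearP.
Qed.
Definition tgpr n : {linear stens -> stens} := mklin (tgpr_linear n).

Lemma tgpr_pure m i j (x : X) (y : Y) : homog i x -> homog j y ->
  tgpr m (x \ox y) = if (m == i + j)%N then x \ox y else 0.
Proof.
move=> hx hy; rewrite mklinE /tgpr_fun.
have e (l : 'I_m.+1) : tmap (gpr l) (gpr (m - l)) (x \ox y) =
    if (l == i :> nat) && (m - l == j)%N then x \ox y else 0.
  rewrite tmapE (gpr_homog _ hx) (gpr_homog _ hy).
  by do 2!case: eqP; rewrite ?(bilin0l (pure_bilin _ _)) ?(bilin0r (pure_bilin _ _)).
rewrite (eq_bigr _ (fun l _ => e l)) -big_mkcond /=.
case: eqP => [mij|mij].
  have im : (i < m.+1)%N by rewrite mij ltnS leq_addr.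
  rewrite (big_pred1 (Ordinal im)) // => l /=.
  rewrite -[l == Ordinal im]/(l == i :> nat).
  by case: eqP => // ->; rewrite mij addKn eqxx.
rewrite big1 // => l /andP [/eqP li /eqP mj]; case: mij.
by rewrite -mj -li subnKC // -ltnS.
Qed.

Fact tgpr_gpr m n (t : stens) : tgpr m (tgpr n t) = if m == n then tgpr n t else 0.
Proof.
elim/tensor_hind: t => [|s t hs ht|i j x y hx hy].
- by rewrite !linear0 if_same.
- by rewrite !linearD hs ht; case: eqP; rewrite ?addr0.
rewrite !(tgpr_pure _ hx hy); case: (n =P _) => [->|_].
  by rewrite (tgpr_pure _ hx hy).
by rewrite linear0 if_same.
Qed.

Fact tgpr_fin (t : stens) : exists N, t == \sum_(n < N) tgpr n t.
Proof.
suff [N h] : exists N, forall M, (N <= M)%N -> t = \sum_(n < M) tgpr n t.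
  by exists N; apply/eqP/h.
elim/tensor_hind: t => [|s t [N hs] [M ht]|i j x y hx hy].
- by exists 0%N => M _; rewrite big1 // => n _; rewrite linear0.
- exists (maxn N M) => L; rewrite geq_max => /andP [hN hM].
  rewrite {1}(hs _ hN) {1}(ht _ hM) -big_split /=.
  by apply: eq_bigr => n _; rewrite linearD.
exists (i + j).+1 => M hM; rewrite (bigD1 (Ordinal hM)) //=.
rewrite (tgpr_pure _ hx hy) eqxx big1 ?addr0 // => n ne.
by rewrite (tgpr_pure _ hx hy) -[(_ == _)%N]/(n == Ordinal hM) (negPf ne).
Qed.

Fact tgpr_1 : tgpr 0 (1 : stens) = 1.
Proof. by rewrite (tgpr_pure _ (homog1 X) (homog1 Y)). Qed.

Fact tgpr_M m n (s t : stens) :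
  tgpr m s = s -> tgpr n t = t -> tgpr (m + n) (s * t) = s * t.
Proof.
move=> <- <-; move: s t.
have H := stmul_bilin.
elim/tensor_hind => [|s s' hs hs'|i j a b ha hb] t.
- by rewrite !(linear0, mul0r).
- by rewrite linearD mulrDl linearD hs hs'.
rewrite (tgpr_pure _ ha hb); case: eqP => [->|_]; last by rewrite mul0r linear0.
elim/tensor_hind: t => [|t t' ht ht'|i' j' c d hc hd].
- by rewrite !(linear0, mulr0).
- by rewrite linearD mulrDr linearD ht ht'.
rewrite (tgpr_pure _ hc hd); case: eqP => [->|_]; last by rewrite mulr0 linear0.
rewrite -[_ * _]/(stmul _ _) (stmul_pure _ _ hb hc) linearZ_LR /=; congr (_ *: _).
by rewrite (tgpr_pure _ (homogM ha hc) (homogM hb hd)) addnACA eqxx.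
Qed.

Definition gtensor : galg k := Galg tgpr_gpr tgpr_fin tgpr_1 tgpr_M.

Lemma gtensor_mulE m n (a : X) (b : Y) (c : X) (d : Y) :
  homog m b -> homog n c ->
  (a \ox b : gtensor) * (c \ox d : gtensor) =
    (-1) ^+ (m * n) *: ((a * c) \ox (b * d)).
Proof. exact: stmul_pure. Qed.

Lemma gtensor_pr n (t : gtensor) :
  gpr n t = \sum_(i < n.+1) tmap (gpr i) (gpr (n - i)) t.
Proof. exact: mklinE. Qed.

Lemma gtensor_homog m n (x : X) (y : Y) : homog m x -> homog n y ->
  homog (m + n) (x \ox y : gtensor).
Proof. by move=> hx hy; rewrite /homog /= (tgpr_pure _ hx hy) eqxx. Qed.

End SuperTensor.

Notation "X '\og' Y" := (gtensor X Y) (at level 40, left associativity).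

Section TensorOne.
Variables (k : fieldType) (X Y : galg k).
Notation T := (X \og Y).

Lemma gtensor_mul1l (a c : X) (d : Y) :
  (a \ox 1 : T) * (c \ox d) = (a * c) \ox d.
Proof.
elim/gind: c => [|c c' hc hc'|n c hc].
- by rewrite mulr0 !(bilin0l (pure_bilin _ _)) mulr0.
- by rewrite mulrDr !(bilinDl (pure_bilin _ _)) -hc -hc'; apply: mulrDr.
by rewrite (gtensor_mulE _ _ (homog1 _) hc) expr0 scale1r mul1r.
Qed.

Lemma gtensor_mul1r (a : X) (b d : Y) :
  (a \ox b : T) * (1 \ox d) = a \ox (b * d).
Proof.
elim/gind: b => [|b b' hb hb'|n b hb].
- by rewrite mul0r !(bilin0r (pure_bilin _ _)) mul0r.
- by rewrite mulrDl !(bilinDr (pure_bilin _ _)) -hb -hb'; apply: mulrDl.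
by rewrite (gtensor_mulE _ _ hb (homog1 _)) muln0 expr0 scale1r mulr1.
Qed.

End TensorOne.

Record dga (k : fieldType) := Dga {
  dga_galg :> galg k;
  dd : {linear dga_galg -> dga_galg};
  dd_homog : forall n x, homog n x -> homog n.+1 (dd x);
  dd_dd : forall x, dd (dd x) = 0;
  dd_M : forall n x y, homog n x ->
    dd (x * y) = dd x * y + (-1) ^+ n *: (x * dd y)
}.
Arguments dd {k d}.

Definition is_ghom (k : fieldType) (X Y : galg k) (f : {linear X -> Y}) : Prop :=
  monoid_morphism f /\ forall n x, homog n x -> homog n (f x).

Definition is_dgahom (k : fieldType) (X Y : dga k) (f : {linear X -> Y}) : Prop :=
  is_ghom f /\ forall x, f (dd x) = dd (f x).

Section DgaTensor.
Variables (k : fieldType) (X Y : dga k).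
Notation T := (gtensor X Y).

Fact tdd_linear :
  linear (fun t : X \ot Y => tmap dd idfun t + tmap (gsign X) dd t).
Proof. by move=> a x y; rewrite !linearP scalerDr addrACA. Qed.
Definition tdd : {linear T -> T} := mklin tdd_linear.

Lemma tddE n (x : X) (y : Y) : homog n x ->
  tdd (x \ox y) = dd x \ox y + (-1) ^+ n *: (x \ox dd y).
Proof.
move=> hx; rewrite mklinE !tmapE /= (gsignE hx).
by rewrite (bilinZl (pure_bilin _ _)).
Qed.

Fact tdd_homog n (t : T) : homog n t -> homog n.+1 (tdd t).
Proof.
move=> <-; elim/tensor_hind: t => [|s t hs ht|i j x y hx hy].
- by rewrite !linear0; apply: homog0.
- by rewrite !linearD; apply: homogD.
rewrite /= (tgpr_pure _ hx hy); case: eqP => [->|_]; last first.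
  by rewrite linear0; apply: homog0.
rewrite (tddE _ hx); apply: homogD.
  by rewrite -addSn; apply: gtensor_homog => //; apply: dd_homog.
by apply: homogZ; rewrite -addnS; apply: gtensor_homog => //; apply: dd_homog.
Qed.

Fact tdd_dd (t : T) : tdd (tdd t) = 0.
Proof.
elim/tensor_hind: t => [|s t hs ht|i j x y hx hy].
- by rewrite !linear0.
- by rewrite !linearD hs ht addr0.
rewrite (tddE _ hx) linearD linearZ_LR /= (tddE _ hx) (tddE _ (dd_homog hx)).
rewrite !dd_dd (bilin0l (pure_bilin _ _)) (bilin0r (pure_bilin _ _)).
by rewrite add0r scaler0 addr0 exprS mulN1r scaleNr addNr.
Qed.

Fact tdd_M n (s t : T) : homog n s ->
  tdd (s * t) = tdd s * t + (-1) ^+ n *: (s * tdd t).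
Proof.
move=> <-; elim/tensor_hind: s t => [|s s' hs hs'|i j a b ha hb] t.
- by rewrite !(linear0, mul0r, scaler0, addr0).
- by rewrite linearD mulrDl linearD hs hs' linearD !mulrDl scalerDr addrACA.
rewrite /= (tgpr_pure _ ha hb); case: eqP => [->|_]; last first.
  by rewrite !(linear0, mul0r, scaler0, addr0).
elim/tensor_hind: t => [|t t' ht ht'|p q c d hc hd].
- by rewrite !(linear0, mulr0, scaler0, addr0).
- by rewrite mulrDr !linearD ht ht' !mulrDr linearD addrACA.
rewrite (gtensor_mulE _ _ hb hc) linearZ_LR /= (tddE _ (homogM ha hc)).
rewrite (tddE _ ha) (tddE _ hc) mulrDl mulrDr -scalerAl -scalerAr.
rewrite (gtensor_mulE _ _ hb hc) (gtensor_mulE _ _ (dd_homog hb) hc).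
rewrite (gtensor_mulE _ _ hb (dd_homog hc)) (gtensor_mulE _ _ hb hc).
rewrite (dd_M _ ha) (dd_M _ hb).
rewrite (bilinDl (pure_bilin X Y)) (bilinDr (pure_bilin X Y)).
rewrite (bilinZl (pure_bilin X Y)) (bilinZr (pure_bilin X Y)).
rewrite !scalerDr !scalerA -!exprD -!addrA; congr (_ + _).
have sgE u v : odd u = odd v -> (-1) ^+ u = (-1) ^+ v :> k.
  by move=> e; rewrite -signr_odd e signr_odd.
rewrite addrCA (sgE (j * p + (i + p))%N (i + j.+1 * p)%N); last first.
  by rewrite ?mulSn ?mulnS !(oddD, oddM); case: (odd i) (odd j) (odd p) => [] [] [].
rewrite (sgE (j * p + i)%N (i + j + j * p.+1)%N); last first.
  by rewrite ?mulSn ?mulnS !(oddD, oddM); case: (odd i) (odd j) (odd p) => [] [] [].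
rewrite (sgE (j * p + (i + p) + j)%N (i + j + p + j * p)%N) //.
by rewrite ?mulSn ?mulnS !(oddD, oddM); case: (odd i) (odd j) (odd p) => [] [] [].
Qed.

Definition dtensor : dga k := Dga tdd_homog tdd_dd tdd_M.

Lemma dtensor_ddE n (x : X) (y : Y) : homog n x ->
  dd (x \ox y : dtensor) = dd x \ox y + (-1) ^+ n *: (x \ox dd y).
Proof. exact: tddE. Qed.

Lemma dtensor_dd (t : dtensor) : dd t = tmap dd idfun t + tmap (gsign X) dd t.
Proof. exact: mklinE. Qed.

End DgaTensor.

Notation "X '\od' Y" := (dtensor X Y) (at level 40, left associativity).

(* Exterior algebras on A: the inclusion ext_in identifies A with the degree 0
   part. *)
Record extAlg (k : fieldType) (A : algType k) := ExtAlg {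
  ext_dga :> dga k;
  ext_in : {lrmorphism A -> ext_dga};
  ext_in_inj : injective ext_in;
  ext_homog0 : forall x, homog 0 x <-> exists a, x = ext_in a;
  ext_homog1 : forall x, homog 1 x ->
    exists s : seq (A * A), x = \sum_(p <- s) ext_in p.1 * dd (ext_in p.2);
  ext_gen : forall P : set ext_dga,
    (forall x, homog 0 x -> P x) -> (forall x, homog 1 x -> P x) ->
    (forall a x y, P x -> P y -> P (a *: x + y)) ->
    (forall x y, P x -> P y -> P (x * y)) -> forall x, P x
}.
Arguments ext_in {k A} e.

Definition concentrated (k : fieldType) (X : galg k) : Prop :=
  forall x : X, homog 0 x.

Section ExtRetract.
Variables (k : fieldType) (A : algType k) (Om : extAlg A).

Fact ext_retr_ex x : exists a, gpr 0 x = ext_in Om a.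
Proof. exact/(ext_homog0 _).1/homog_gpr. Qed.
Definition ext_retr_fun x : A := sval (cid (ext_retr_ex x)).
Lemma ext_retrE_fun x : ext_in Om (ext_retr_fun x) = gpr 0 x.
Proof. by rewrite /ext_retr_fun; case: cid. Qed.
Fact ext_retr_linear : linear ext_retr_fun.
Proof.
move=> a x y; apply: (@ext_in_inj _ _ Om).
by rewrite ext_retrE_fun !linearP /= !ext_retrE_fun.
Qed.
Definition ext_retr : {linear Om -> A} := mklin ext_retr_linear.
Lemma ext_retrE x : ext_in Om (ext_retr x) = gpr 0 x.
Proof. by rewrite mklinE ext_retrE_fun. Qed.
Lemma ext_in_homog a : homog 0 (ext_in Om a).
Proof. by apply/ext_homog0; exists a. Qed.
Lemma ext_inK : cancel (ext_in Om) ext_retr.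
Proof. by move=> a; apply: (@ext_in_inj _ _ Om); rewrite ext_retrE ext_in_homog. Qed.
End ExtRetract.

Lemma dd1 (k : fieldType) (X : dga k) : dd (1 : X) = 0.
Proof.
have := dd_M (1 : X) (homog1 X).
rewrite expr0 scale1r !mulr1 mul1r => e.
by apply: (addrI (dd (1 : X))); rewrite -e addr0.
Qed.

Section ExtTensor.
Variables (k : fieldType) (X Y : galg k).
Hypotheses (hX : concentrated X) (hY : concentrated Y).
Variables (OX : extAlg X) (OY : extAlg Y).
Notation A := (X \og Y).
Notation Om := (OX \od OY).

Fact ext_tin_linear : linear (tmap (ext_in OX) (ext_in OY) : A -> Om).
Proof. exact: linearP. Qed.

Fact ext_tin_monoid : monoid_morphism (tmap (ext_in OX) (ext_in OY) : A -> Om).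
Proof.
split; first by rewrite tmapE !rmorph1.
elim/tensor_ind => [t|s s' hs hs' t|a b].
- by rewrite !(linear0, mul0r).
- by rewrite mulrDl !linearD mulrDl hs hs'.
elim/tensor_ind => [|t t' ht ht'|c d].
- by rewrite !(linear0, mulr0).
- by rewrite mulrDr !linearD mulrDr ht ht'.
rewrite (gtensor_mulE _ _ (hY b) (hX c)) expr0 scale1r !tmapE !rmorphM /=.
by rewrite (gtensor_mulE _ _ (ext_in_homog _ _) (ext_in_homog _ _)) expr0 scale1r.
Qed.

Definition ext_tin : {lrmorphism A -> Om} :=
  HB.pack (tmap (ext_in OX) (ext_in OY) : A -> Om)
    (GRing.isLinear.Build k A Om *:%R _ ext_tin_linear)
    (GRing.isMonoidMorphism.Build A Om _ ext_tin_monoid).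

Lemma ext_tinE x y : ext_tin (x \ox y) = ext_in OX x \ox ext_in OY y.
Proof. exact: tmapE. Qed.

Fact ext_tin_inj : injective ext_tin.
Proof.
apply: (can_inj (g := tmap (ext_retr OX) (ext_retr OY))).
elim/tensor_ind => [|s t hs ht|a b].
- by rewrite !linear0.
- by rewrite !linearD hs ht.
by rewrite /ext_tin /= !tmapE !ext_inK.
Qed.

Fact ext_thomog0 (t : Om) : homog 0 t <-> exists a, t = ext_tin a.
Proof.
split=> [<-|[a ->]].
  exists (tmap (ext_retr OX) (ext_retr OY) t).
  elim/tensor_ind: t => [|s t hs ht|x y].
  - by rewrite !linear0.
  - by rewrite !linearD hs ht.
  rewrite gtensor_pr big_ord1 !tmapE.
  by congr (_ \ox _); apply/esym/ext_retrE.
elim/tensor_ind: a => [|s u hs hu|a b].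
- by rewrite linear0; apply: homog0.
- by rewrite linearD; apply: homogD.
by rewrite ext_tinE; apply: (@gtensor_homog _ OX OY 0 0); apply: ext_in_homog.
Qed.

Fact ext_thomog1 (t : Om) : homog 1 t ->
  exists s : seq (A * A), t = \sum_(p <- s) ext_tin p.1 * dd (ext_tin p.2).
Proof.
move=> <-.
pose Q (t : Om) := exists s : seq (A * A),
  t = \sum_(p <- s) ext_tin p.1 * dd (ext_tin p.2).
have Q0 : Q 0 by exists [::]; rewrite big_nil.
have QD x y : Q x -> Q y -> Q (x + y).
  by move=> [s ->] [s' ->]; exists (s ++ s'); rewrite big_cat.
rewrite -/(Q _); elim/tensor_ind: t => [|s t hs ht|x y].
- by rewrite linear0.
- by rewrite linearD; apply: QD.
rewrite gtensor_pr !big_ord_recl big_ord0 addr0 !tmapE; apply: (QD).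
- have [s ->] := ext_homog1 (homog_gpr 1 y).
  rewrite -[gpr _ x]ext_retrE (bilin_sumr (pure_bilin _ _)).
  apply: (big_ind Q Q0 QD) => -[b b'] _; exists [:: (ext_retr OX x \ox b, 1 \ox b')].
  rewrite big_seq1 /= !tmapE rmorph1 (dtensor_ddE _ (homog1 _)).
  rewrite dd1 (bilin0l (pure_bilin _ _)) add0r expr0 scale1r.
  rewrite (gtensor_mulE _ _ (ext_in_homog _ _) (homog1 _)).
  by rewrite expr0 scale1r mulr1.
- have [s ->] := ext_homog1 (homog_gpr 1 x).
  rewrite -[gpr _ y]ext_retrE (bilin_suml (pure_bilin _ _)).
  apply: (big_ind Q Q0 QD) => -[a a'] _; exists [:: (a \ox ext_retr OY y, a' \ox 1)].
  rewrite big_seq1 /= !tmapE rmorph1 (dtensor_ddE _ (ext_in_homog _ _)).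
  rewrite dd1 (bilin0r (pure_bilin _ _)) scaler0 addr0.
  rewrite (gtensor_mulE _ _ (ext_in_homog _ _) (dd_homog (ext_in_homog _ _))).
  by rewrite expr0 scale1r mulr1.
Qed.

Fact ext_tgen (P : set Om) :
  (forall x, homog 0 x -> P x) -> (forall x, homog 1 x -> P x) ->
  (forall a x y, P x -> P y -> P (a *: x + y)) ->
  (forall x y, P x -> P y -> P (x * y)) -> forall x, P x.
Proof.
move=> h0 h1 hL hM.
have Pl x : P (x \ox 1).
  move: x; apply: (@ext_gen _ _ OX (fun x => P (x \ox 1))) => [x hx|x hx|a x y hx hy|x y hx hy].
  - by apply: h0; apply: (gtensor_homog hx (homog1 OY)).
  - by apply: h1; apply: (gtensor_homog hx (homog1 OY)).
  - by rewrite (pure_bilin _ _).1; apply: hL.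
  have := hM _ _ hx hy.
  by rewrite (gtensor_mul1l (X := OX) (Y := OY)).
have Pr y : P (1 \ox y).
  move: y; apply: (@ext_gen _ _ OY (fun y => P (1 \ox y))) => [y hy|y hy|a x y hx hy|x y hx hy].
  - by apply: h0; apply: (gtensor_homog (homog1 OX) hy).
  - by apply: h1; apply: (gtensor_homog (homog1 OX) hy).
  - by rewrite (pure_bilin _ _).2; apply: hL.
  have := hM _ _ hx hy.
  by rewrite (gtensor_mul1r (X := OX) (Y := OY)).
elim/tensor_ind => [|x y hx hy|x y].
- exact/h0/homog0.
- by rewrite -[x]scale1r; apply: hL.
have := hM _ _ (Pl x) (Pr y).
by rewrite (gtensor_mul1l (X := OX) (Y := OY)) mulr1.
Qed.

Definition ext_tensor : extAlg (A : algType k) :=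
  ExtAlg ext_tin_inj ext_thomog0 ext_thomog1 ext_tgen.

End ExtTensor.

Section Multiplication.
Variables (k : fieldType) (X : galg k).

Fact gmul_bilin : bilin (fun x y : X => x * y).
Proof.
by split=> [y|x] a u v; rewrite ?mulrDl ?mulrDr -?scalerAl -?scalerAr.
Qed.
Definition gmul : {linear X \ot X -> X} := tlift gmul_bilin.

Lemma gmulE x y : gmul (x \ox y) = x * y.
Proof. exact: tliftE. Qed.

Definition in_tl (Y : galg k) (x : X) : X \og Y := x \ox 1.
Definition in_tr (Y : galg k) (x : X) : Y \og X := 1 \ox x.

Fact in_tl_linear Y : linear (in_tl Y).
Proof. exact: (pure_bilin _ _).1. Qed.
Fact in_tr_linear Y : linear (in_tr Y).
Proof. exact: (pure_bilin _ _).2. Qed.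
HB.instance Definition _ Y :=
  GRing.isLinear.Build k X (X \og Y) *:%R (in_tl Y) (in_tl_linear Y).
HB.instance Definition _ Y :=
  GRing.isLinear.Build k X (Y \og X) *:%R (in_tr Y) (in_tr_linear Y).

End Multiplication.
Arguments in_tl {k X} Y x.
Arguments in_tr {k X} Y x.

(* Delta and eps are even because they preserve the degree; no signs occur
   below, since such maps pass tensor factors freely. *)
Record is_sbialg (k : fieldType) (X : galg k)
    (Delta : {linear X -> X \og X}) (eps : {scalar X}) : Prop := IsSBialg {
  sbialg_cop_hom : is_ghom Delta;
  sbialg_cou_mul : monoid_morphism eps;
  sbialg_cou_homog : forall n x, homog n x -> (0 < n)%N -> eps x = 0;
  sbialg_coassoc : forall x,
    tassoc (tmap Delta idfun (Delta x)) = tmap idfun Delta (Delta x);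
  sbialg_coul : forall x, tcontl X eps (Delta x) = x;
  sbialg_cour : forall x, tcontr X eps (Delta x) = x
}.

Record sbialg (k : fieldType) := SBialg {
  sbialg_galg :> galg k;
  cop : {linear sbialg_galg -> sbialg_galg \og sbialg_galg};
  cou : {scalar sbialg_galg};
  sbialgP : is_sbialg cop cou
}.
Arguments cop {k} s.
Arguments cou {k} s.

(* An ordinary bialgebra is a super-bialgebra concentrated in degree 0.  Every
   algebra carries such a grading (deg0), and the product of a tensor product of
   concentrated algebras is the usual one (gtensor_mul_conc). *)
Record bialg (k : fieldType) := Bialg {
  bialg_sbialg :> sbialg k;
  bialg_conc : concentrated bialg_sbialg
}.
Arguments bialg_conc {k} b x : rename.

Section Deg0.
Variables (k : fieldType) (A : algType k).

Let pr (n : nat) : {linear A -> A} := if n is 0 then idfun else \0.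
Fact deg0_gpr m n x : pr m (pr n x) = if m == n then pr n x else 0.
Proof. by case: m n => [|m] [|n] //=; case: eqP. Qed.
Fact deg0_fin x : exists N, x == \sum_(n < N) pr n x.
Proof. by exists 1; rewrite big_ord1. Qed.
Fact deg0_M m n x y : pr m x = x -> pr n y = y -> pr (m + n) (x * y) = x * y.
Proof.
by case: m n => [|m] [|n] //= hx hy; rewrite -?hx -?hy /= ?mul0r ?mulr0.
Qed.
Definition deg0 : galg k := Galg deg0_gpr deg0_fin (erefl : pr 0 1 = 1) deg0_M.

Lemma deg0_conc : concentrated deg0.
Proof. by []. Qed.
End Deg0.

Lemma gtensor_mul_conc (k : fieldType) (X Y : galg k)
    (hX : concentrated X) (hY : concentrated Y) (a c : X) (b d : Y) :
  (a \ox b : X \og Y) * (c \ox d) = (a * c) \ox (b * d).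
Proof. by rewrite (gtensor_mulE _ _ (hY b) (hX c)) expr0 scale1r. Qed.

Lemma gtensor_conc (k : fieldType) (X Y : galg k) :
  concentrated X -> concentrated Y -> concentrated (X \og Y).
Proof.
move=> hX hY; elim/tensor_ind => [|s t hs ht|x y]; first exact: homog0.
  exact: homogD.
exact: (gtensor_homog (hX x) (hY y)).
Qed.

Record right_comodule_algebra (k : fieldType) (K : sbialg k) (B : galg k)
    (delta : {linear B -> B \og K}) : Prop := RightComoduleAlgebra {
  rcomod_hom : is_ghom delta;
  rcomod_coassoc : forall b,
    tassoc (tmap delta idfun (delta b)) = tmap idfun (cop K) (delta b);
  rcomod_cou : forall b, tcontr B (cou K) (delta b) = b
}.

Record left_comodule_algebra (k : fieldType) (K : sbialg k) (B : galg k)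
    (delta : {linear B -> K \og B}) : Prop := LeftComoduleAlgebra {
  lcomod_hom : is_ghom delta;
  lcomod_coassoc : forall b,
    tassoc (tmap (cop K) idfun (delta b)) = tmap idfun delta (delta b);
  lcomod_cou : forall b, tcontl B (cou K) (delta b) = b
}.

Section DoubleCross.
Variables (k : fieldType) (A H : sbialg k).
Variables (alpha : {linear A -> A \og H}) (beta : {linear H -> A \og H}).

Record cross_compatible : Prop := CrossCompatible {
  cross_right : @right_comodule_algebra k H A alpha;
  cross_left : @left_comodule_algebra k A H beta;
  cross_alpha : forall w : A,
    tassoc (tmap (cop A) idfun (alpha w)) =
    gmul (A \og (A \og H))
      (tmap (tmap idfun beta \o alpha) (in_tr A \o alpha) (cop A w));
  cross_beta : forall h : H,
    tassocV (tmap idfun (cop H) (beta h)) =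
    gmul ((A \og H) \og H)
      (tmap (in_tl H \o beta) (tmap alpha idfun \o beta) (cop H h));
  cross_comm : forall m n (w : A) (h : H), homog m w -> homog n h ->
    alpha w * beta h = (-1) ^+ (m * n) *: (beta h * alpha w)
}.

(* h \ox a |-> (-1)^(|a||h|) alpha(a) beta(h) *)
Definition dcc_mid : {linear H \ot A -> A \ot H} :=
  gmul (A \og H) \o tmap alpha beta \o sflip.

(* (h1 \ox h2) \ox (a1 \ox a2) |-> h1 \ox dcc_mid (h2 \ox a1) \ox a2, bracketed
   as an element of (H \ox A) \ox (H \ox A) *)
Definition dcc_shuffle :
    {linear (H \ot H) \ot (A \ot A) -> (H \ot A) \ot (H \ot A)} :=
  tassocV \o tmap idfun tassoc \o tmap idfun (tmap dcc_mid idfun)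
    \o tmap idfun tassocV \o tassoc.

Lemma dcc_midE m n (h : H) (a : A) : homog m a -> homog n h ->
  dcc_mid (h \ox a) = (-1) ^+ (m * n) *: (alpha a * beta h).
Proof.
move=> ha hh; rewrite /dcc_mid /= (sflipE hh ha) mulnC.
rewrite [tmap _ _ _]linearZ_LR [LHS]linearZ_LR; congr (_ *: _).
apply: (etrans (congr1 _ (tmapE _ _ _ _))).
exact (@gmulE k (A \og H) (alpha a) (beta h)).
Qed.

Lemma dcc_shuffleE m n (h1 h2 : H) (a1 a2 : A) : homog m a1 -> homog n h2 ->
  dcc_shuffle ((h1 \ox h2) \ox (a1 \ox a2)) =
  (-1) ^+ (m * n) *: tassocV (h1 \ox tassoc ((alpha a1 * beta h2) \ox a2)).
Proof.
move=> ha hh; rewrite /dcc_shuffle [LHS]/= tassocE tmapE tassocVE.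
rewrite (tmapE idfun) (tmapE dcc_mid) (dcc_midE ha hh).
rewrite (bilinZl (pure_bilin _ _)) tmapE [in LHS]linearZ_LR.
by rewrite (bilinZr (pure_bilin _ _)) [LHS]linearZ_LR.
Qed.

Definition dcc_cop : {linear H \og A -> (H \og A) \og (H \og A)} :=
  dcc_shuffle \o tmap (cop H) (cop A).

Definition dcc_cou : {scalar H \og A} := cou A \o tcontl A (cou H).

(* For bialgebras without antipode the compatibility conditions do not imply
   that the tensor product counit is a counit, hence the second field. *)
Record double_cross_coproduct : Prop := DoubleCrossCoproduct {
  dcc_compatible : cross_compatible;
  dcc_sbialgP : is_sbialg dcc_cop dcc_cou
}.

Definition dcc (h : double_cross_coproduct) : sbialg k := SBialg (dcc_sbialgP h).

Definition dcc_coactL : {linear H -> (H \og A) \og H} :=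
  tassocV \o tmap idfun beta \o cop H.
Definition dcc_coactR : {linear A -> A \og (H \og A)} :=
  tassoc \o tmap alpha idfun \o cop A.

End DoubleCross.

(* A coaction differentiates to an extension along the inclusions of the degree
   0 parts; the target factors (C, D) are (B, K) or (K, B). *)
Definition is_extension (k : fieldType) (B : algType k) (C D : galg k)
    (OB : extAlg B) (OC : extAlg C) (OD : extAlg D)
    (delta : {linear B -> C \og D}) (deltas : {linear OB -> OC \od OD}) : Prop :=
  is_dgahom deltas /\
  forall b, deltas (ext_in OB b) = tmap (ext_in OC) (ext_in OD) (delta b).

Definition differentiable (k : fieldType) (B : algType k) (C D : galg k)
    (OB : extAlg B) (OC : extAlg C) (OD : extAlg D)
    (delta : {linear B -> C \og D}) : Prop :=
  exists deltas : {linear OB -> OC \od OD}, is_extension delta deltas.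

Record sbicov (k : fieldType) (A : bialg k) := SBicov {
  sbicov_ext :> extAlg A;
  scop : {linear sbicov_ext -> sbicov_ext \od sbicov_ext};
  scou : {scalar sbicov_ext};
  sbicov_sbialgP : is_sbialg scop scou;
  sbicov_extends : is_extension (cop A) scop
}.

Definition sbicov_sbialg (k : fieldType) (A : bialg k) (O : sbicov A) : sbialg k :=
  SBialg (sbicov_sbialgP O).
Coercion sbicov_sbialg : sbicov >-> sbialg.

(* Main.v *)
Require Import Defs.
From HB Require Import structures.
From mathcomp Require Import all_boot all_order all_algebra.

(** The coalgebra side of a double cross coproduct depends on alpha, beta only
    through the middle map mid : H (x) A -> A (x) H that sends h (x) a to
    (-1)^(|a||h|) alpha(a) beta(h).  The super-commutation of alpha and beta
    rewrites this as mid(h (x) a) = beta(h) alpha(a), without a sign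
    ([dcc_mid_comm]), and the two conditions on coproducts become

      (Delta (x) id) alpha(a) = (id (x) mid) (alpha(a_1) (x) a_2)
      (id (x) Delta) beta(h)  = (mid (x) id) (h_1 (x) beta(h_2))

    ([cross_alpha_mid], [cross_beta_mid]), where no product and no sign is left.

    Coassociativity is then a computation with linear maps between coalgebras.
    For Delta_L h = h_1 (x) beta(h_2), the coaction property of beta gives

      (Delta (x) id) Delta_L h = h_1 (x) mid(h_2 (x) a) (x) beta(g),
        where a (x) g = beta(h_3),

    and the condition on beta displayed above turns (id (x) Delta_L) Delta_L h
    into the same element ([cross_coactL_coassoc]).  Delta_R is the mirror image
    ([cross_coactR_coassoc]).

    Both coactions are composites of a coproduct, of alpha or beta tensored with
    an identity, and of an associativity isomorphism.  Each of these is a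
    homomorphism of graded algebras, hence the comodule algebra property.  On the
    exterior algebras each is a homomorphism of differential graded algebras, so
    the same formulas with alpha_*, beta_* and the coproducts of the exterior
    algebras give differential graded homomorphisms; by naturality
    ([cross_coactL_nat], [cross_coactR_nat]) they extend Delta_L and Delta_R. *)

Set Implicit Arguments.
Unset Strict Implicit.
Unset Printing Implicit Defensive.

Import GRing.Theory.
Local Open Scope ring_scope.

(** * Tensor products of vector spaces *)

Section TensorSpaces.
Variable k : fieldType.

Lemma tassocK (U V W : lmodType k) : cancel (@tassoc k U V W) tassocV.
Proof.
elim/tensor_ind => [|s t hs ht|t w]; rewrite ?linear0 ?linearD ?hs ?ht //.
elim/tensor_ind: t => [|s t hs ht|u v].
- by rewrite (bilin0l (pure_bilin _ _)) !linear0.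
- by rewrite (bilinDl (pure_bilin _ _)) !linearD hs ht.
by rewrite tassocE tassocVE.
Qed.

Lemma tassocVK (U V W : lmodType k) : cancel (@tassocV k U V W) tassoc.
Proof.
elim/tensor_ind => [|s t hs ht|u t]; rewrite ?linear0 ?linearD ?hs ?ht //.
elim/tensor_ind: t => [|s t hs ht|v w].
- by rewrite (bilin0r (pure_bilin _ _)) !linear0.
- by rewrite (bilinDr (pure_bilin _ _)) !linearD hs ht.
by rewrite tassocVE tassocE.
Qed.

Lemma eq_tmap (A A' H H' : lmodType k) (f f' : {linear A -> A'}) (g g' : {linear H -> H'}) :
  f =1 f' -> g =1 g' -> tmap f g =1 tmap f' g'.
Proof. by move=> ef eg; apply: tensor_ext => v w; rewrite !tmapE ef eg. Qed.

Lemma tensor_indl (U V W : lmodType k) (P : (U \ot V) \ot W -> Prop) :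
  P 0 -> (forall s t, P s -> P t -> P (s + t)) ->
  (forall u v w, P (u \ox v \ox w)) -> forall t, P t.
Proof.
move=> h0 hD hP; elim/tensor_ind => // t w.
elim/tensor_ind: t => [|s t hs ht|u v] //.
  by rewrite (bilin0l (pure_bilin _ _)).
by rewrite (bilinDl (pure_bilin _ _)); apply: hD.
Qed.

Lemma tensor_indr (U V W : lmodType k) (P : U \ot (V \ot W) -> Prop) :
  P 0 -> (forall s t, P s -> P t -> P (s + t)) ->
  (forall u v w, P (u \ox (v \ox w))) -> forall t, P t.
Proof.
move=> h0 hD hP; elim/tensor_ind => // u t.
elim/tensor_ind: t => [|s t hs ht|v w] //.
  by rewrite (bilin0r (pure_bilin _ _)).
by rewrite (bilinDr (pure_bilin _ _)); apply: hD.
Qed.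

End TensorSpaces.

(** * Coalgebras crossed by a middle map *)

(** These are the formulas of the double cross coproduct and of its coactions,
    for arbitrary linear maps in place of the structure maps.  With
    [mid := dcc_mid alpha beta] they are convertible to [dcc_shuffle],
    [dcc_cop], [dcc_coactL] and [dcc_coactR], in degree 0 as well as on forms. *)
Section CrossCoalgebra.
Variables (k : fieldType) (A H : lmodType k).
Variables (cA : {linear A -> A \ot A}) (cH : {linear H -> H \ot H}).
Variables (alpha : {linear A -> A \ot H}) (beta : {linear H -> A \ot H}).
Variable mid : {linear H \ot A -> A \ot H}.

Definition cross_shuffle :
    {linear (H \ot H) \ot (A \ot A) -> (H \ot A) \ot (H \ot A)} :=
  tassocV \o tmap idfun tassoc \o tmap idfun (tmap mid idfun)
    \o tmap idfun tassocV \o tassoc.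

Definition cross_cop : {linear H \ot A -> (H \ot A) \ot (H \ot A)} :=
  cross_shuffle \o tmap cH cA.

Definition cross_coactL : {linear H -> (H \ot A) \ot H} :=
  tassocV \o tmap idfun beta \o cH.
Definition cross_coactR : {linear A -> A \ot (H \ot A)} :=
  tassoc \o tmap alpha idfun \o cA.

Lemma cross_shuffleE h1 h2 a1 a2 :
  cross_shuffle ((h1 \ox h2) \ox (a1 \ox a2)) =
  tassocV (h1 \ox tassoc (mid (h2 \ox a1) \ox a2)).
Proof. by rewrite /cross_shuffle /= tassocE !tmapE tassocVE !tmapE. Qed.

Lemma cross_copE h a : cross_cop (h \ox a) = cross_shuffle (cH h \ox cA a).
Proof. by rewrite /cross_cop [LHS]/= tmapE. Qed.

Lemma cross_coactLE h : cross_coactL h = tassocV (tmap idfun beta (cH h)).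
Proof. by []. Qed.

Lemma cross_coactRE a : cross_coactR a = tassoc (tmap alpha idfun (cA a)).
Proof. by []. Qed.

(** The coproduct of H (x) A applied to the left leg of Delta_L needs the
    coproduct of the A-leg of beta(h_2), which the coaction property of beta
    replaces by a second use of beta.  The result depends on h only through
    h_1 (x) (h_2 (x) h_3). *)
Lemma cop_cross_coactL h :
  (forall h, tassoc (tmap cH idfun (cH h)) = tmap idfun cH (cH h)) ->
  (forall h, tassoc (tmap cA idfun (beta h)) = tmap idfun beta (beta h)) ->
  tassoc (tmap cross_cop idfun (cross_coactL h)) =
  tassoc (tmap cross_shuffle idfun (tassocV
    (tmap idfun (tassocV \o tmap idfun beta \o beta)
      (tassocV (tmap idfun cH (cH h)))))).
Proof.
move=> cHA cAb; rewrite cross_coactLE.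
have -> : tassocV (tmap idfun cH (cH h)) = tmap cH idfun (cH h).
  by rewrite -cHA tassocK.
have e (x : H \ot (A \ot H)) :
    tassoc (tmap cross_cop idfun (tassocV x)) =
    tassoc (tmap cross_shuffle idfun (tassocV
      (tmap cH (tmap cA idfun) x))).
  elim/tensor_indr: x => [|s t hs ht|g a g'].
  - by rewrite !linear0.
  - by rewrite !linearD hs ht.
  by rewrite tassocVE !tmapE tassocVE tmapE cross_copE.
rewrite e; congr (tassoc (tmap _ _ (tassocV _))).
elim/tensor_ind: (cH h) => [|s t hs ht|g g'].
- by rewrite !linear0.
- by rewrite !linearD hs ht.
by rewrite !tmapE /= -cAb tassocK.
Qed.

(** The right-hand side isolates (id (x) cH) beta(h_2), the element that the
    compatibility condition on beta rewrites. *)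
Lemma cross_coactL_cross_coactL h :
  tmap idfun cross_coactL (cross_coactL h) =
  tassocV (tmap idfun (tmap idfun (tassocV \o tmap idfun beta) \o tassoc)
    (tmap idfun (tassocV \o tmap idfun cH \o beta) (cH h))).
Proof.
rewrite [in LHS]cross_coactLE.
elim/tensor_ind: (cH h) => [|s t hs ht|g g'].
- by rewrite !linear0.
- by rewrite !linearD hs ht.
rewrite !tmapE [in RHS]/= tassocVK.
elim/tensor_ind: (beta g') => [|s t hs ht|a g''].
- by rewrite (bilin0r (pure_bilin _ _)) !linear0 (bilin0r (pure_bilin _ _)) linear0.
- by rewrite (bilinDr (pure_bilin _ _)) !linearD hs ht (bilinDr (pure_bilin _ _)) linearD.
by rewrite !tmapE !tassocVE tmapE.
Qed.

(** After the compatibility condition, both sides are linear in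
    h_1 (x) (h_2 (x) h_3), and on a pure tensor g1 (x) (g2 (x) g3) both equal
    g1 (x) mid(g2 (x) a) (x) beta(g4), where a (x) g4 = beta(g3). *)
Lemma cross_coactL_coassoc h :
  (forall h, tassoc (tmap cH idfun (cH h)) = tmap idfun cH (cH h)) ->
  (forall h, tassoc (tmap cA idfun (beta h)) = tmap idfun beta (beta h)) ->
  (forall h, tassocV (tmap idfun cH (beta h)) =
    tmap mid idfun (tassocV (tmap idfun beta (cH h)))) ->
  tassoc (tmap cross_cop idfun (cross_coactL h)) =
  tmap idfun cross_coactL (cross_coactL h).
Proof.
move=> cHA cAb cHb; rewrite (cop_cross_coactL h cHA cAb) cross_coactL_cross_coactL.
have -> : tmap idfun (tassocV \o tmap idfun cH \o beta) (cH h) =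
    tmap idfun (tmap mid idfun \o tassocV \o tmap idfun beta)
      (tmap idfun cH (cH h)).
  elim/tensor_ind: (cH h) => [|s t hs ht|g g'].
  - by rewrite !linear0.
  - by rewrite !linearD hs ht.
  by rewrite !tmapE /= cHb.
elim/tensor_indr: (tmap idfun cH (cH h)) => [|s t hs ht|g1 g2 g3].
- by rewrite !linear0.
- by rewrite !linearD hs ht.
rewrite tassocVE !tmapE /= tmapE.
elim/tensor_ind: (beta g3) => [|s t hs ht|a g4].
- by do !rewrite (linear0, bilin0r (pure_bilin _ _)).
- by do !rewrite (linearD, bilinDr (pure_bilin _ _)); rewrite hs ht.
rewrite tassocVE !tmapE.
(* This exposes beta g4 on the right, so that beta g4 and then mid (g2 \ox a)
   can be replaced by pure tensors on both sides at once. *)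
have -> t : tmap idfun (tassocV \o tmap idfun beta) (tassoc (t \ox idfun g4)) =
    tmap idfun tassocV (tassoc (t \ox beta g4)).
  elim/tensor_ind: t => [|s t hs ht|b c].
  - by rewrite !(bilin0l (pure_bilin _ _)) !linear0.
  - by rewrite !(bilinDl (pure_bilin _ _)) !linearD hs ht.
  by rewrite !tassocE !tmapE /= tmapE.
elim/tensor_ind: (beta g4) => [|s t hs ht|a' g'].
- by do !rewrite (linear0, bilin0r (pure_bilin _ _)).
- by do !rewrite (linearD, bilinDr (pure_bilin _ _)); rewrite hs ht.
rewrite !tassocVE tmapE cross_shuffleE.
elim/tensor_ind: (mid (g2 \ox a)) => [|s t hs ht|b c].
- by do !rewrite (linear0, bilin0r (pure_bilin _ _), bilin0l (pure_bilin _ _)).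
- by do !rewrite (linearD, bilinDr (pure_bilin _ _), bilinDl (pure_bilin _ _)); rewrite hs ht.
by rewrite !tassocE tmapE !tassocVE tassocE.
Qed.

(** Here the coproduct of the H-leg of alpha(a_1) is replaced by a second use of
    alpha, by the coaction property of alpha. *)
Lemma cop_cross_coactR a :
  (forall a, tassoc (tmap cA idfun (cA a)) = tmap idfun cA (cA a)) ->
  (forall a, tassoc (tmap alpha idfun (alpha a)) = tmap idfun cH (alpha a)) ->
  tmap idfun cross_cop (cross_coactR a) =
  tmap idfun cross_shuffle (tassoc
    (tmap (tassoc \o tmap alpha idfun \o alpha) idfun
      (tassoc (tmap cA idfun (cA a))))).
Proof.
move=> cAA cHa; rewrite cross_coactRE cAA.
have e (x : (A \ot H) \ot A) :
    tmap idfun cross_cop (tassoc x) =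
    tmap idfun cross_shuffle (tassoc (tmap (tmap idfun cH) cA x)).
  elim/tensor_indl: x => [|s t hs ht|c g c'].
  - by rewrite !linear0.
  - by rewrite !linearD hs ht.
  by rewrite tassocE !tmapE tassocE tmapE cross_copE.
rewrite e; congr (tmap _ _ (tassoc _)).
elim/tensor_ind: (cA a) => [|s t hs ht|c c'].
- by rewrite !linear0.
- by rewrite !linearD hs ht.
by rewrite !tmapE /= -cHa.
Qed.

(** The right-hand side isolates (cA (x) id) alpha(a_1), the element that the
    compatibility condition on alpha rewrites. *)
Lemma cross_coactR_cross_coactR a :
  tassoc (tmap cross_coactR idfun (cross_coactR a)) =
  tassoc (tassoc (tmap (tmap (tassoc \o tmap alpha idfun) idfun \o tassocV) idfun
    (tmap (tassoc \o tmap cA idfun \o alpha) idfun (cA a)))).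
Proof.
rewrite [in LHS]cross_coactRE; congr (tassoc _).
elim/tensor_ind: (cA a) => [|s t hs ht|c c'].
- by rewrite !linear0.
- by rewrite !linearD hs ht.
rewrite !tmapE [in RHS]/= tassocK.
elim/tensor_ind: (alpha c) => [|s t hs ht|b g].
- by do !rewrite (linear0, bilin0l (pure_bilin _ _)).
- by do !rewrite (linearD, bilinDl (pure_bilin _ _)); rewrite hs ht.
by rewrite !tmapE !tassocE tmapE.
Qed.

(** On a pure tensor (a1 (x) a2) (x) a3 in place of (a_1 (x) a_2) (x) a_3, both
    sides equal alpha(b) (x) mid(g (x) a2) (x) a3, where b (x) g = alpha(a1). *)
Lemma cross_coactR_coassoc a :
  (forall a, tassoc (tmap cA idfun (cA a)) = tmap idfun cA (cA a)) ->
  (forall a, tassoc (tmap alpha idfun (alpha a)) = tmap idfun cH (alpha a)) ->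
  (forall a, tassoc (tmap cA idfun (alpha a)) =
    tmap idfun mid (tassoc (tmap alpha idfun (cA a)))) ->
  tassoc (tmap cross_coactR idfun (cross_coactR a)) =
  tmap idfun cross_cop (cross_coactR a).
Proof.
move=> cAA cHa cAa; rewrite (cop_cross_coactR a cAA cHa) cross_coactR_cross_coactR.
have -> : tmap (tassoc \o tmap cA idfun \o alpha) idfun (cA a) =
    tmap (tmap idfun mid \o tassoc \o tmap alpha idfun) idfun
      (tmap cA idfun (cA a)).
  elim/tensor_ind: (cA a) => [|s t hs ht|c c'].
  - by rewrite !linear0.
  - by rewrite !linearD hs ht.
  by rewrite !tmapE /= cAa.
elim/tensor_indl: (tmap cA idfun (cA a)) => [|s t hs ht|a1 a2 a3].
- by rewrite !linear0.
- by rewrite !linearD hs ht.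
rewrite tassocE !tmapE /= tmapE.
elim/tensor_ind: (alpha a1) => [|s t hs ht|b g].
- by do !rewrite (linear0, bilin0l (pure_bilin _ _)).
- by do !rewrite (linearD, bilinDl (pure_bilin _ _)); rewrite hs ht.
rewrite tassocE !tmapE.
(* This exposes alpha b on the left, so that alpha b and then mid (g \ox a2)
   can be replaced by pure tensors on both sides at once. *)
have -> t : tmap (tassoc \o tmap alpha idfun) idfun (tassocV (idfun b \ox t)) =
    tmap tassoc idfun (tassocV (alpha b \ox t)).
  elim/tensor_ind: t => [|s t hs ht|c h].
  - by rewrite !(bilin0r (pure_bilin _ _)) !linear0.
  - by rewrite !(bilinDr (pure_bilin _ _)) !linearD hs ht.
  by rewrite !tassocVE !tmapE /= tmapE.
elim/tensor_ind: (alpha b) => [|s t hs ht|x g'].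
- by do !rewrite (linear0, bilin0l (pure_bilin _ _)).
- by do !rewrite (linearD, bilinDl (pure_bilin _ _)); rewrite hs ht.
rewrite !tassocE tmapE cross_shuffleE.
elim/tensor_ind: (mid (g \ox a2)) => [|s t hs ht|c h].
- by do !rewrite (linear0, bilin0r (pure_bilin _ _), bilin0l (pure_bilin _ _)).
- by do !rewrite (linearD, bilinDr (pure_bilin _ _), bilinDl (pure_bilin _ _)); rewrite hs ht.
by rewrite tassocVE tmapE !tassocE tassocVE.
Qed.

Lemma cross_coactL_cou (eA : {scalar A}) (eH : {scalar H}) h :
  (forall h, tcontl H eH (cH h) = h) ->
  (forall h, tcontl H eA (beta h) = h) ->
  tcontl H (eA \o tcontl A eH) (cross_coactL h) = h.
Proof.
move=> eHl eAb; rewrite -[RHS]eHl cross_coactLE.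
elim/tensor_ind: (cH h) => [|s t hs ht|g g'].
- by rewrite !linear0.
- by rewrite !linearD hs ht.
rewrite tmapE tcontlE -[in RHS](eAb g').
elim/tensor_ind: (beta g') => [|s t hs ht|a g''].
- by rewrite (bilin0r (pure_bilin _ _)) !linear0 ?scaler0.
- by rewrite (bilinDr (pure_bilin _ _)) !linearD hs ht ?scalerDr.
by rewrite tassocVE !tcontlE /= tcontlE linearZ_LR /= scalerA.
Qed.

Lemma cross_coactR_cou (eA : {scalar A}) (eH : {scalar H}) a :
  (forall a, tcontr A eA (cA a) = a) ->
  (forall a, tcontr A eH (alpha a) = a) ->
  tcontr A (eA \o tcontl A eH) (cross_coactR a) = a.
Proof.
move=> eAr eHa; rewrite -[RHS]eAr cross_coactRE.
elim/tensor_ind: (cA a) => [|s t hs ht|c c'].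
- by rewrite !linear0.
- by rewrite !linearD hs ht.
rewrite tmapE tcontrE -[in RHS](eHa c).
elim/tensor_ind: (alpha c) => [|s t hs ht|b g].
- by rewrite (bilin0l (pure_bilin _ _)) !linear0 ?scaler0.
- by rewrite (bilinDl (pure_bilin _ _)) !linearD hs ht ?scalerDr.
by rewrite tassocE !tcontrE /= tcontlE linearZ_LR /= scalerA mulrC.
Qed.

End CrossCoalgebra.

Section Naturality.
Variables (k : fieldType) (A A' H H' : lmodType k).
Variables (i : {linear A -> A'}) (j : {linear H -> H'}).

(** Applied to the inclusions of the degree 0 parts of exterior algebras, these
    two lemmas say that the coactions built from the extended structure maps
    extend the original coactions. *)
Lemma cross_coactL_nat (cH : {linear H -> H \ot H}) (cH' : {linear H' -> H' \ot H'})
    (beta : {linear H -> A \ot H}) (beta' : {linear H' -> A' \ot H'}) h :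
  (forall h, cH' (j h) = tmap j j (cH h)) ->
  (forall h, beta' (j h) = tmap i j (beta h)) ->
  cross_coactL cH' beta' (j h) = tmap (tmap j i) j (cross_coactL cH beta h).
Proof.
move=> ecH ebeta; rewrite !cross_coactLE ecH.
elim/tensor_ind: (cH h) => [|s t hs ht|g g'].
- by rewrite !linear0.
- by rewrite !linearD hs ht.
rewrite !tmapE ebeta.
elim/tensor_ind: (beta g') => [|s t hs ht|a g''].
- by do !rewrite (linear0, bilin0r (pure_bilin _ _)).
- by do !rewrite (linearD, bilinDr (pure_bilin _ _)); rewrite hs ht.
by rewrite !tmapE !tassocVE !tmapE.
Qed.

Lemma cross_coactR_nat (cA : {linear A -> A \ot A}) (cA' : {linear A' -> A' \ot A'})
    (alpha : {linear A -> A \ot H}) (alpha' : {linear A' -> A' \ot H'}) a :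
  (forall a, cA' (i a) = tmap i i (cA a)) ->
  (forall a, alpha' (i a) = tmap i j (alpha a)) ->
  cross_coactR cA' alpha' (i a) = tmap i (tmap j i) (cross_coactR cA alpha a).
Proof.
move=> ecA ealpha; rewrite !cross_coactRE ecA.
elim/tensor_ind: (cA a) => [|s t hs ht|c c'].
- by rewrite !linear0.
- by rewrite !linearD hs ht.
rewrite !tmapE ealpha.
elim/tensor_ind: (alpha c) => [|s t hs ht|b g].
- by do !rewrite (linear0, bilin0l (pure_bilin _ _)).
- by do !rewrite (linearD, bilinDl (pure_bilin _ _)); rewrite hs ht.
by rewrite !tmapE !tassocE !tmapE.
Qed.

End Naturality.

(** * Homomorphisms of graded and differential graded algebras *)

Section GradedHoms.
Variable k : fieldType.

Lemma ghom_id (X : galg k) : is_ghom (idfun : {linear X -> X}).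
Proof. by []. Qed.

(** The composite is a third map, given up to pointwise equality, because a linear
    map between tensor product algebras may carry a module structure that is
    the expected one only after unfolding. *)
Lemma ghom_comp (X Y Z : galg k) (f : {linear X -> Y}) (g : {linear Y -> Z})
    (h : {linear X -> Z}) :
  h =1 g \o f -> is_ghom f -> is_ghom g -> is_ghom h.
Proof.
move=> e [[f1 fM] fh] [[g1 gM] gh]; split.
  by split=> [|x y]; rewrite !e /= ?f1 ?fM.
by move=> n x hx; rewrite e; apply/gh/fh.
Qed.

Lemma dgahom_comp (X Y Z : dga k) (f : {linear X -> Y}) (g : {linear Y -> Z})
    (h : {linear X -> Z}) :
  h =1 g \o f -> is_dgahom f -> is_dgahom g -> is_dgahom h.
Proof.
move=> e [fg fd] [gg gd]; split; first exact: ghom_comp e fg gg.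
by move=> x; rewrite !e /= fd gd.
Qed.

Lemma ghom_inv (X Y : galg k) (f : {linear X -> Y}) (g : {linear Y -> X}) :
  cancel f g -> cancel g f -> is_ghom f -> is_ghom g.
Proof.
move=> fK gK [[f1 fM] fh]; split; first split.
- by rewrite -f1 fK.
- by move=> x y; apply: (can_inj fK); rewrite fM !gK.
move=> n y hy; apply: (can_inj fK); rewrite gK.
(* A degree-preserving map commutes with the projections, and so does its
   inverse. *)
have fpr i x : f (gpr i x) = gpr i (f x).
  elim/gind: x => [|x x' hx hx'|j x hx]; rewrite ?linear0 ?linearD ?hx ?hx' //.
  rewrite (gpr_homog _ hx) (gpr_homog _ (fh _ _ hx)).
  by case: eqP; rewrite ?linear0.
by rewrite fpr gK.
Qed.

Lemma dgahom_inv (X Y : dga k) (f : {linear X -> Y}) (g : {linear Y -> X}) :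
  cancel f g -> cancel g f -> is_dgahom f -> is_dgahom g.
Proof.
move=> fK gK [fg fd]; split; first exact: ghom_inv fK gK fg.
by move=> y; apply: (can_inj fK); rewrite fd !gK.
Qed.

(** The tensor product is spanned by pure tensors, and the sign in the product of
    two of them involves only the inner factors b and c; so only these need to
    be homogeneous. *)
Lemma tensor_ghom (X Y Z : galg k) (f : {linear X \og Y -> Z}) :
  f (1 \ox 1) = 1 ->
  (forall m n a b c d, homog m b -> homog n c ->
    (-1) ^+ (m * n) *: f ((a * c) \ox (b * d)) = f (a \ox b) * f (c \ox d)) ->
  (forall m n x y, homog m x -> homog n y -> homog (m + n) (f (x \ox y))) ->
  is_ghom f.
Proof.
move=> f1 fM fh; split; first split=> //.
  elim/tensor_hind => [t|s s' hs hs' t|i j a b ha hb].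
  - by rewrite !(linear0, mul0r).
  - by rewrite mulrDl !linearD mulrDl hs hs'.
  elim/tensor_hind => [|t t' ht ht'|i' j' c d hc hd].
  - by rewrite !(linear0, mulr0).
  - by rewrite mulrDr !linearD mulrDr ht ht'.
  by rewrite (gtensor_mulE _ _ hb hc) linearZ_LR /= (fM _ _ _ _ _ _ hb hc).
move=> n t <-; elim/tensor_hind: t => [|s t hs ht|i j x y hx hy].
- by rewrite !linear0; apply: homog0.
- by rewrite !linearD; apply: homogD.
rewrite (gpr_homog _ (gtensor_homog hx hy)); case: eqP => [->|_].
  exact: fh.
by rewrite linear0; apply: homog0.
Qed.

Lemma tmap_ghom (X X' Y Y' : galg k) (f : {linear X -> X'}) (g : {linear Y -> Y'}) :
  is_ghom f -> is_ghom g -> is_ghom (tmap f g : {linear X \og Y -> X' \og Y'}).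
Proof.
move=> [[f1 fM] fh] [[g1 gM] gh]; apply: tensor_ghom => [|m n a b c d hb hc|m n x y hx hy].
- by rewrite tmapE f1 g1.
- by rewrite !tmapE fM gM (gtensor_mulE _ _ (gh _ _ hb) (fh _ _ hc)).
- by rewrite tmapE; apply: gtensor_homog; [apply: fh | apply: gh].
Qed.

Lemma tmap_dgahom (X X' Y Y' : dga k) (f : {linear X -> X'}) (g : {linear Y -> Y'}) :
  is_dgahom f -> is_dgahom g -> is_dgahom (tmap f g : {linear X \od Y -> X' \od Y'}).
Proof.
move=> [fg fd] [gg gd]; split; first exact: tmap_ghom.
elim/tensor_hind => [|s t hs ht|i j x y hx hy].
- by rewrite !linear0.
- by rewrite !linearD hs ht.
rewrite (dtensor_ddE _ hx) linearD linearZ_LR /= !tmapE fd gd.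
by rewrite (dtensor_ddE _ (fg.2 _ _ hx)).
Qed.

End GradedHoms.

Section Associator.
Variable k : fieldType.

(** A homogeneous element of a tensor product is a sum of pure tensors of
    homogeneous elements of the same total degree, because the projection onto
    a degree keeps or kills each pure tensor. *)
Lemma gtensor_homog_ind (X Y : galg k) n (P : X \og Y -> Prop) :
  P 0 -> (forall s t, P s -> P t -> P (s + t)) ->
  (forall i j x y, homog i x -> homog j y -> n = (i + j)%N -> P (x \ox y)) ->
  forall t, homog n t -> P t.
Proof.
move=> h0 hD hP t <-; elim/tensor_hind: t => [|s t hs ht|i j x y hx hy].
- by rewrite linear0.
- by rewrite linearD; apply: hD.
rewrite (gpr_homog _ (gtensor_homog hx hy)); case: eqP => // e.
exact: hP hx hy e.
Qed.

(** No sign enters the definition of the associator; moving x' past y (x) b, and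
    y' past b, gives the same sign as moving x' (x) y' past b, and x' past y. *)
Lemma tassoc_ghom (X Y Z : galg k) :
  is_ghom (tassoc : {linear (X \og Y) \og Z -> X \og (Y \og Z)}).
Proof.
apply: tensor_ghom => [|m n a b c d hb hc|m n t z ht hz].
- exact: tassocE.
- move: c hc a; apply: gtensor_homog_ind.
  + by move=> a; rewrite mulr0 !(bilin0l (pure_bilin _ _)) !linear0 ?scaler0 mulr0.
  + move=> c c' hc hc' a.
    by rewrite mulrDr !(bilinDl (pure_bilin _ _)) !linearD mulrDr -hc -hc' ?scalerDr.
  move=> i' j' x' y' hx' hy' ->; elim/tensor_hind => [|a a' ha ha'|i j x y hx hy].
  + by rewrite mul0r !(bilin0l (pure_bilin _ _)) !linear0 ?scaler0 mul0r.
  + by rewrite mulrDl !(bilinDl (pure_bilin _ _)) !linearD mulrDl -ha -ha' ?scalerDr.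
  rewrite (gtensor_mulE _ _ hy hx') (bilinZl (pure_bilin _ _)) linearZ_LR !tassocE.
  rewrite (gtensor_mulE _ _ (gtensor_homog hy hb) hx') (gtensor_mulE _ _ hb hy').
  rewrite (bilinZr (pure_bilin _ _)) !scalerA -!exprD.
  have -> // : ((j + m) * i' + m * j' = m * (i' + j') + j * i')%N.
  by rewrite mulnDl mulnDr -addnA addnC.
move: t ht; apply: gtensor_homog_ind.
- by rewrite (bilin0l (pure_bilin _ _)) linear0; apply: homog0.
- by move=> s t hs ht; rewrite (bilinDl (pure_bilin _ _)) linearD; apply: homogD.
move=> i j x y hx hy ->; rewrite tassocE -addnA.
by apply: gtensor_homog => //; apply: gtensor_homog.
Qed.

Lemma tassoc_dgahom (X Y Z : dga k) :
  is_dgahom (tassoc : {linear (X \od Y) \od Z -> X \od (Y \od Z)}).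
Proof.
split; first exact: tassoc_ghom.
elim/tensor_ind => [|s t hs ht|t z]; rewrite ?linear0 ?linearD ?hs ?ht //.
elim/tensor_hind: t => [|s t hs ht|i j x y hx hy].
- by rewrite (bilin0l (pure_bilin _ _)) !linear0.
- by rewrite (bilinDl (pure_bilin _ _)) !linearD hs ht.
rewrite (@dtensor_ddE k (X \od Y) Z _ _ _ (gtensor_homog hx hy)) (dtensor_ddE _ hx).
rewrite (bilinDl (pure_bilin _ _)) (bilinZl (pure_bilin _ _)).
rewrite !linearD !linearZ_LR /= !tassocE (dtensor_ddE _ hx) (dtensor_ddE _ hy).
by rewrite (bilinDr (pure_bilin _ _)) (bilinZr (pure_bilin _ _)) scalerDr scalerA exprD addrA.
Qed.

Lemma tassocV_ghom (X Y Z : galg k) :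
  is_ghom (tassocV : {linear X \og (Y \og Z) -> (X \og Y) \og Z}).
Proof.
exact: (@ghom_inv k ((X \og Y) \og Z) (X \og (Y \og Z)) tassoc tassocV
  (@tassocK k X Y Z) (@tassocVK k X Y Z) (tassoc_ghom X Y Z)).
Qed.

Lemma tassocV_dgahom (X Y Z : dga k) :
  is_dgahom (tassocV : {linear X \od (Y \od Z) -> (X \od Y) \od Z}).
Proof.
exact: (@dgahom_inv k ((X \od Y) \od Z) (X \od (Y \od Z)) tassoc tassocV
  (@tassocK k X Y Z) (@tassocVK k X Y Z) (tassoc_dgahom X Y Z)).
Qed.

End Associator.

Section CoactionHoms.
Variable k : fieldType.

Lemma cross_coactL_ghom (A H : galg k) (cH : {linear H -> H \og H})
    (beta : {linear H -> A \og H}) :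
  is_ghom cH -> is_ghom beta ->
  is_ghom (cross_coactL cH beta : {linear H -> (H \og A) \og H}).
Proof.
move=> hc hb; pose f : {linear H \og H -> H \og (A \og H)} := tmap idfun beta.
pose g : {linear H \og (A \og H) -> (H \og A) \og H} := tassocV.
have hf : is_ghom f by exact: tmap_ghom (ghom_id H) hb.
have hfc : is_ghom (f \o cH) by exact: ghom_comp (frefl _) hc hf.
apply: (ghom_comp (f := f \o cH) (g := g)).
- exact: (cross_coactLE cH beta).
- exact: hfc.
- exact: tassocV_ghom.
Qed.

Lemma cross_coactR_ghom (A H : galg k) (cA : {linear A -> A \og A})
    (alpha : {linear A -> A \og H}) :
  is_ghom cA -> is_ghom alpha ->
  is_ghom (cross_coactR cA alpha : {linear A -> A \og (H \og A)}).
Proof.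
move=> hc ha; pose f : {linear A \og A -> (A \og H) \og A} := tmap alpha idfun.
pose g : {linear (A \og H) \og A -> A \og (H \og A)} := tassoc.
have hf : is_ghom f by exact: tmap_ghom ha (ghom_id A).
have hfc : is_ghom (f \o cA) by exact: ghom_comp (frefl _) hc hf.
apply: (ghom_comp (f := f \o cA) (g := g)).
- exact: (cross_coactRE cA alpha).
- exact: hfc.
- exact: tassoc_ghom.
Qed.

Lemma cross_coactL_dgahom (A H : dga k) (cH : {linear H -> H \od H})
    (beta : {linear H -> A \od H}) :
  is_dgahom cH -> is_dgahom beta ->
  is_dgahom (cross_coactL cH beta : {linear H -> (H \od A) \od H}).
Proof.
move=> hc hb; pose f : {linear H \od H -> H \od (A \od H)} := tmap idfun beta.
pose g : {linear H \od (A \od H) -> (H \od A) \od H} := tassocV.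
have hf : is_dgahom f by apply: tmap_dgahom hb.
have hfc : is_dgahom (f \o cH) by exact: dgahom_comp (frefl _) hc hf.
apply: (dgahom_comp (f := f \o cH) (g := g)).
- exact: (cross_coactLE cH beta).
- exact: hfc.
- exact: tassocV_dgahom.
Qed.

Lemma cross_coactR_dgahom (A H : dga k) (cA : {linear A -> A \od A})
    (alpha : {linear A -> A \od H}) :
  is_dgahom cA -> is_dgahom alpha ->
  is_dgahom (cross_coactR cA alpha : {linear A -> A \od (H \od A)}).
Proof.
move=> hc ha; pose f : {linear A \od A -> (A \od H) \od A} := tmap alpha idfun.
pose g : {linear (A \od H) \od A -> A \od (H \od A)} := tassoc.
have hf : is_dgahom f by apply: tmap_dgahom ha _.
have hfc : is_dgahom (f \o cA) by exact: dgahom_comp (frefl _) hc hf.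
apply: (dgahom_comp (f := f \o cA) (g := g)).
- exact: (cross_coactRE cA alpha).
- exact: hfc.
- exact: tassoc_dgahom.
Qed.

End CoactionHoms.

(** * Double cross coproducts *)

Section DoubleCross.
Variables (k : fieldType) (A H : sbialg k).
Variables (alpha : {linear A -> A \og H}) (beta : {linear H -> A \og H}).
Hypothesis cc : cross_compatible alpha beta.

(** The sign in the definition of the middle map cancels the sign of the
    super-commutation of alpha and beta. *)
Lemma dcc_mid_comm h a : dcc_mid alpha beta (h \ox a) = beta h * alpha a.
Proof.
elim/gind: h => [|h h' hh hh'|n h hh].
- by rewrite (bilin0l (pure_bilin _ _)) !linear0 mul0r.
- by rewrite (bilinDl (pure_bilin _ _)) !linearD mulrDl hh hh'.
elim/gind: a => [|a a' ha ha'|m a ha].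
- by rewrite (bilin0r (pure_bilin _ _)) !linear0 mulr0.
- by rewrite (bilinDr (pure_bilin _ _)) !linearD mulrDr ha ha'.
by rewrite (dcc_midE _ _ ha hh) (cross_comm cc ha hh) scalerA -expr2 sqrr_sign scale1r.
Qed.

(** If alpha(c) = b (x) g, then the product of b (x) beta(g) and 1 (x) alpha(c')
    is b (x) beta(g) alpha(c'): the factor 1 has degree 0, so no sign appears,
    and the last two legs are the value of the middle map on g (x) c'. *)
Lemma cross_alpha_mid a :
  tassoc (tmap (cop A) idfun (alpha a)) =
  tmap idfun (dcc_mid alpha beta) (tassoc (tmap alpha idfun (cop A a))).
Proof.
apply: etrans (cross_alpha cc a) _.
elim/tensor_ind: (cop A a) => [|s t hs ht|c c'].
- by rewrite !linear0.
- by rewrite !linearD hs ht.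
rewrite !tmapE gmulE /=.
elim/tensor_ind: (alpha c) => [|s t hs ht|b g].
- by rewrite (bilin0l (pure_bilin _ _)) !linear0 mul0r.
- by rewrite (bilinDl (pure_bilin _ _)) !linearD mulrDl hs ht.
rewrite tassocE !tmapE dcc_mid_comm.
exact: (gtensor_mul1r (X := A) (Y := A \og H)).
Qed.

Lemma cross_beta_mid h :
  tassocV (tmap idfun (cop H) (beta h)) =
  tmap (dcc_mid alpha beta) idfun (tassocV (tmap idfun beta (cop H h))).
Proof.
apply: etrans (cross_beta cc h) _.
elim/tensor_ind: (cop H h) => [|s t hs ht|g g'].
- by rewrite !linear0.
- by rewrite !linearD hs ht.
rewrite !tmapE gmulE /=.
elim/tensor_ind: (beta g') => [|s t hs ht|a g''].
- by rewrite (bilin0r (pure_bilin _ _)) !linear0 mulr0.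
- by rewrite (bilinDr (pure_bilin _ _)) !linearD mulrDr hs ht.
rewrite tassocVE !tmapE dcc_mid_comm.
exact: (gtensor_mul1l (X := A \og H) (Y := H)).
Qed.

End DoubleCross.

Theorem corollary3p11 (k : fieldType) (A H : bialg k)
    (alpha : {linear A -> A \og H}) (beta : {linear H -> A \og H})
    (dc : double_cross_coproduct alpha beta) :
  (left_comodule_algebra (K := dcc dc) (dcc_coactL beta) /\
   right_comodule_algebra (K := dcc dc) (dcc_coactR alpha)) /\
  forall (OA : sbicov A) (OH : sbicov H)
    (alphas : {linear OA -> OA \od OH}) (betas : {linear OH -> OA \od OH}),
    is_extension alpha alphas -> is_extension beta betas ->
    cross_compatible (A := OA) (H := OH) alphas betas ->
    let OHA := ext_tensor (bialg_conc H) (bialg_conc A) OH OA in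
    differentiable OH OHA OH (dcc_coactL beta) /\
    differentiable OA OA OHA (dcc_coactR alpha).
Proof.
have cc := dcc_compatible dc; split; first split.
- have [hb bA bc] := cross_left cc; have [hH _ _ cHA eHl _] := sbialgP H.
  split.
  + exact: cross_coactL_ghom hH hb.
  + by move=> h; exact: (cross_coactL_coassoc h cHA bA (cross_beta_mid cc)).
  + by move=> h; exact: (cross_coactL_cou h eHl bc).
- have [ha aH ac] := cross_right cc; have [hA _ _ cAA _ eAr] := sbialgP A.
  split.
  + exact: cross_coactR_ghom hA ha.
  + by move=> a; exact: (cross_coactR_coassoc a cAA aH (cross_alpha_mid cc)).
  + by move=> a; exact: (cross_coactR_cou a eAr ac).
move=> OA OH alphas betas [halpha ealpha] [hbeta ebeta] _ OHA.
have [hcA ecA] := sbicov_extends OA; have [hcH ecH] := sbicov_extends OH.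
split.
  exists (cross_coactL (scop OH) betas); split.
    exact: cross_coactL_dgahom hcH hbeta.
  move=> h; apply: etrans (cross_coactL_nat (i := ext_in OA) (j := ext_in OH) h ecH ebeta) _.
  (* The inclusion of H \og A into its exterior algebra agrees with the tensor
     product of the two inclusions as a function. *)
  by apply: eq_tmap.
exists (cross_coactR (scop OA) alphas); split.
  exact: cross_coactR_dgahom hcA halpha.
move=> a; apply: etrans (cross_coactR_nat (i := ext_in OA) (j := ext_in OH) a ecA ealpha) _.
by apply: eq_tmap.
Qed.
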